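(* Let $k\in\mathbb{N}$, $k\ge1$, and let $m_0\in C_c^k(\mathbb{R})$ with $\mathrm{supp}\{m_0\}\subset(-L,L)$. Let $T_{max}(m_0)$ denote the maximal existence time of the classical solution to the mCH equation with initial datum $m_0$, and let $u_0=G\ast m_0$. (i) We have $$T_{max}(m_0)\ge\frac{1}{\|m_0\|_{L^\infty}\|m_0\|_{L^1}}.$$ (ii) If there exists $\overline{\xi}\in[-L,L]$ such that $$m_0(\overline\xi)\,\partial_xu_0(\overline\xi)<0,\qquad |m_0(\overline\xi)|\,(\partial_xu_0(\overline\xi))^2>\frac12\|m_0\|_{L^1}^3,$$ then the classical solution to the mCH equation with initial datum $m_0$ blows up in finite time. Moreover, for any $\epsilon>0$ we have $$\frac{1}{\|m_0\|_{L^\infty}\|m_0\|_{L^1}}\cdot\frac1{\epsilon^2}\le T_{max}(\epsilon m_0)\le\frac{1}{\|m_0\|_{L^1}^2}\cdot\frac1{\epsilon^2}.$$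
   Context: $L>0$ is a fixed constant. $G(x)=\frac12e^{-|x|}$ is the fundamental solution of $1-\partial_{xx}$ on $\mathbb{R}$. The mCH equation with initial datum $m_0$ is $$m_t+[(u^2-u_x^2)m]_x=0,\quad m=u-u_{xx},\quad x\in\mathbb{R},\ t>0,\qquad m(x,0)=m_0(x),$$ with $u=G\ast m$. A classical solution on $[0,T)$ is a pair $u\in C_1^{k+2}(\mathbb{R}\times[0,T))$, $m\in C_1^k(\mathbb{R}\times[0,T))$ satisfying these pointwise, where $C_n^k(\mathbb{R}\times I)$ is the set of functions $w$ with $\partial_x^\beta w$ continuous on $\mathbb{R}\times I$ for $0\le\beta\le k$ and $\partial_t^\alpha w$ continuous for $0\le\alpha\le n$. The maximal existence time $T_{max}$ is characterized by $\|m(\cdot,t)\|_{L^\infty}<+\infty$ for $0\le t<T_{max}$ and, if $T_{max}<+\infty$, $\limsup_{t\to T_{max}}\|m(\cdot,t)\|_{L^\infty}=+\infty$; ''blows up in finite time'' means $T_{max}<+\infty$. Convention: $1/0=+\infty$. *)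

(* Defs.v *)
From HB Require Import structures.
From mathcomp Require Import all_boot all_order all_algebra.
From mathcomp Require Import all_classical all_reals all_analysis.

Set Implicit Arguments.
Unset Strict Implicit.
Unset Printing Implicit Defensive.

Import Order.TTheory GRing.Theory Num.Theory.
Import numFieldNormedType.Exports.

Local Open Scope classical_set_scope.
Local Open Scope ring_scope.

Definition LebesgueMeasure (R : realType) :
  {measure set (measurableTypeR R) -> \bar R} := @lebesgue_measure R.

Definition normL1 (R : realType) (f : R -> R) : \bar R :=
  Lnorm (LebesgueMeasure R) 1%E (EFin \o f).

Definition normLinf (R : realType) (f : R -> R) : \bar R :=
  Lnorm (LebesgueMeasure R) +oo%E (EFin \o f).

Definition tsupport (R : realType) (f : R -> R) : set R :=
  closure [set x | f x != 0].

Definition Ck (R : realType) (k : nat) (f : R -> R) : Prop :=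
  (forall b x, (b < k)%N -> derivable (derive1n b f) x 1) /\
  (forall b, (b <= k)%N -> continuous (derive1n b f)).

Definition Cck (R : realType) (k : nat) (f : R -> R) : Prop :=
  Ck k f /\ compact (tsupport f).

Definition G (R : realType) (x : R) : R := 2^-1 * expR (- `|x|).

Definition convG (R : realType) (f : R -> R) (x : R) : R :=
  \int[LebesgueMeasure R]_(y in setT) (G (x - y) * f y).

(* [Rintegral] is total, so the absolute convergence of the convolution has to
   be required separately. *)
Definition convG_defined (R : realType) (f : R -> R) (x : R) : Prop :=
  (LebesgueMeasure R).-integrable setT (EFin \o (fun y => G (x - y) * f y)).

(* Derivative of [f] at [t] relative to [I]: it is one-sided at an endpoint
   of [I] belonging to [I], and the ordinary one in the interior of [I]. *)
Definition diff_quot (R : realType) (f : R -> R) (t h : R) : R :=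
  h^-1 * (f (h + t) - f t).

Definition derivable_in (R : realType) (I : set R) (f : R -> R) (t : R) : Prop :=
  cvg (diff_quot f t h @[h --> within (fun h => I (h + t)) 0^']).

Definition derive_in (R : realType) (I : set R) (f : R -> R) (t : R) : R :=
  lim (diff_quot f t h @[h --> within (fun h => I (h + t)) 0^']).

(* The space $C_n^k(\mathbb{R} \times I)$; functions of (x, t) are curried as
   [w x t]. *)
Definition Cnk (R : realType) (n k : nat) (I : set R) (w : R -> R -> R) : Prop :=
  [/\ forall b x t, (b < k)%N -> I t -> derivable (derive1n b (w^~ t)) x 1,
      forall b, (b <= k)%N ->
        {within [set: R] `*` I,
          continuous (fun z : R * R => derive1n b (w^~ z.2) z.1)},
      forall a x t, (a < n)%N -> I t ->
        derivable_in I (iter a (derive_in I) (w x)) t &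
      forall a, (a <= n)%N ->
        {within [set: R] `*` I,
          continuous (fun z : R * R => iter a (derive_in I) (w z.1) z.2)}].

(* The interval $[0, T)$, where $T$ may be infinite. *)
Definition time_interval (R : realType) (T : \bar R) : set R :=
  [set t | 0 <= t /\ (t%:E < T)%E].

Definition mCH_classical_solution (R : realType) (k : nat) (m0 : R -> R)
    (T : \bar R) (u m : R -> R -> R) : Prop :=
  let I := time_interval T in
  [/\ Cnk 1 k.+2 I u,
      Cnk 1 k I m,
      forall x t, I t -> convG_defined (m^~ t) x /\ u x t = convG (m^~ t) x,
      forall x t, I t -> 0 < t ->
        m x t = u x t - derive1n 2 (u^~ t) x /\
        derive1 (m x) t
          + derive1
              (fun y => (u y t ^+ 2 - derive1 (u^~ t) y ^+ 2) * m y t) x = 0 &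
      forall x, m x 0 = m0 x].

(* [T] is the maximal existence time of the classical solution with initial
   datum [m0]; it may be [+oo]. *)
Definition is_Tmax (R : realType) (k : nat) (m0 : R -> R) (T : \bar R) : Prop :=
  (0 < T)%E /\
  exists u m : R -> R -> R,
    [/\ mCH_classical_solution k m0 T u m,
        forall t, time_interval T t -> (normLinf (m^~ t) < +oo)%E &
        (T < +oo)%E ->
          limf_esup (fun t => normLinf (m^~ t)) (fine T)^'- = +oo%E].

(* Main.v *)
Require Import Defs.
From HB Require Import structures.
From mathcomp Require Import all_boot all_order all_algebra.
From mathcomp Require Import all_classical all_reals all_analysis.
From mathcomp Require Import ess_sup_inf ring lra.

Set Implicit Arguments.
Unset Strict Implicit.
Unset Printing Implicit Defensive.

Import Order.TTheory GRing.Theory Num.Theory.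
Import numFieldNormedType.Exports.

Local Open Scope classical_set_scope.
Local Open Scope ring_scope.

(* With V = u^2 - ux^2 one has V_x = 2 ux m, so the equation reads
   m_t + V m_x = - 2 ux m^2.

   The definition of a solution gives no bound on m that is locally uniform in
   time, so mass coming in from infinity must be excluded.  Where m vanishes on a
   half-line, V_x = 0 there; hence the region m = 0 moves rigidly, and since
   u = c e^x on a left half-line free of m, in fact V = 0 and the support of m
   stays in [-L, L].

   Then ||m(t)||_1 <= ||m0||_1 =: M, by regularising |m| as sqrt (m^2 + e^2), and
   |u|, |ux| <= M/2, |V| <= M^2/4, while the material derivative of ux,
   V u - G * (V m), is at most M^3/4.  Part (i) is the Riccati bound
   |m_t + V m_x| <= M m^2.  For (ii), along the characteristic from xi the
   quantity 1/m has derivative 2 ux <= - 2 p + M^3 t / 2 with p = |ux(xi, 0)|, so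
   1/m would be negative at t = 2 p / M^3 <= 1/M^2.  No flow map is constructed:
   the characteristics are replaced by maximum points, at which the x-derivative
   vanishes. *)

(** * Calculus *)

(** Confining the support replaces uniformity in space by compactness: all integrals live on
    [[-L, L]], V vanishes at both ends so that no flux crosses them, and a positive maximum of a
    quantity containing the factor [m] is attained at an interior point.

    In a product of functions carried by the same velocity V, the V-terms of the time derivative
    combine into V times the x-derivative of the product, so they drop out at a spatial maximum;
    this is why a maximum point can stand in for a characteristic.

    The bound M^3/4 is M^3/8 from V u plus M^3/8 from G * (V m). Integrating the bound on (1/m)' up
    to 2 p / M^3 gives 1/m0 - 3 p^2 / M^3. The factor 1/2 in the hypothesis makes this negative with
    a margin, and the margin pays for a strictly decreasing weight and for a start at a small
    positive time, the equation being available only for t > 0. *)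

Section Pointwise.
Variable R : realType.
Implicit Types (f g : R -> R) (x a b : R).

Lemma is_derive_const (c x : R) : is_derive x 1 (fun=> c) 0.
Proof. exact: is_derive_cst. Qed.

Lemma is_derive_var x : is_derive x 1 (fun z : R => z) 1.
Proof. exact: is_derive_id. Qed.

Lemma is_derive_add f g x a b : is_derive x 1 f a -> is_derive x 1 g b ->
  is_derive x 1 (fun z => f z + g z) (a + b).
Proof. by move=> df dg; exact: is_deriveD. Qed.

Lemma is_derive_sub f g x a b : is_derive x 1 f a -> is_derive x 1 g b ->
  is_derive x 1 (fun z => f z - g z) (a - b).
Proof. by move=> df dg; exact: is_deriveB. Qed.

Lemma is_derive_opp f x a : is_derive x 1 f a -> is_derive x 1 (fun z => - f z) (- a).
Proof. by move=> df; exact: is_deriveN. Qed.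

Lemma is_derive_mul f g x a b : is_derive x 1 f a -> is_derive x 1 g b ->
  is_derive x 1 (fun z => f z * g z) (f x * b + a * g x).
Proof.
move=> df dg; apply: (is_derive_eq (is_deriveM df dg)).
by rewrite /GRing.scale/= [a * _]mulrC.
Qed.

Lemma is_derive_compose f g x a b : is_derive x 1 g b -> is_derive (g x) 1 f a ->
  is_derive x 1 (fun z => f (g z)) (a * b).
Proof. by move=> dg df; exact: (is_derive1_comp df dg). Qed.

Lemma is_derive_sqr f x a : is_derive x 1 f a ->
  is_derive x 1 (fun z => f z ^+ 2) (2 * f x * a).
Proof.
move=> df; have e : (fun z => f z ^+ 2) = (fun z => f z * f z) by [].
by rewrite e; apply: (is_derive_eq (is_derive_mul df df)); ring.
Qed.

End Pointwise.

Section Continuity.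
Variables (R : realType) (T : topologicalType).
Implicit Types f g : T -> R.

Lemma continuous_const (c : R) : continuous (fun _ : T => c).
Proof. exact: cst_continuous. Qed.

Lemma continuous_add f g : continuous f -> continuous g -> continuous (fun z => f z + g z).
Proof. by move=> cf cg z; exact: (cvgD (cf z) (cg z)). Qed.

Lemma continuous_opp f : continuous f -> continuous (fun z => - f z).
Proof. by move=> cf z; exact: (cvgN (cf z)). Qed.

Lemma continuous_mul f g : continuous f -> continuous g -> continuous (fun z => f z * g z).
Proof. by move=> cf cg z; exact: (cvgM (cf z) (cg z)). Qed.

Lemma continuous_pow f n : continuous f -> continuous (fun z => f z ^+ n).
Proof. by move=> cf z; exact: (continuous_comp (cf z) (@exprn_continuous R n _)). Qed.

Lemma continuous_norm_of f : continuous f -> continuous (fun z => `|f z|).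
Proof. by move=> cf z; exact: (cvg_norm (cf z)). Qed.

Lemma continuous_max_of f g : continuous f -> continuous g ->
  continuous (fun z => Num.max (f z) (g z)).
Proof. by move=> cf cg z; exact: (continuous_max (cf z) (cg z)). Qed.

Lemma continuous_min_of f g : continuous f -> continuous g ->
  continuous (fun z => Num.min (f z) (g z)).
Proof. by move=> cf cg z; exact: (continuous_min (cf z) (cg z)). Qed.

Lemma continuous_exp_of f : continuous f -> continuous (fun z => expR (f z)).
Proof. by move=> cf z; exact: (continuous_comp (cf z) (@continuous_expR R _)). Qed.

Lemma continuous_sqrt_of f : continuous f -> continuous (fun z => Num.sqrt (f z)).
Proof. by move=> cf z; exact: (continuous_comp (cf z) (@sqrt_continuous R _)). Qed.

Lemma continuous_inv_of f : (forall z, f z != 0) -> continuous f -> continuous (fun z => (f z)^-1).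
Proof. by move=> f0 cf z; exact: (cvgV (f0 z) (cf z)). Qed.

Lemma continuous_var : continuous (fun z : T => z).
Proof. by move=> z; exact: cvg_id. Qed.

Lemma continuous_compose (U : topologicalType) (f : U -> R) (p : T -> U) :
  continuous f -> continuous p -> continuous (fun z => f (p z)).
Proof. by move=> cf cp z; exact: (continuous_comp (cp z) (cf _)). Qed.

Lemma continuous_pairing (U W : topologicalType) (p : T -> U) (q : T -> W) :
  continuous p -> continuous q -> continuous (fun z => (p z, q z)).
Proof. by move=> cp cq z; exact: (cvg_pair (cp z) (cq z)). Qed.

End Continuity.

Definition continuous2 (R : realType) (f : R -> R -> R) :=
  continuous (fun z : R * R => f z.1 z.2).

Lemma continuous2_comp (R : realType) (T : topologicalType) (f : R -> R -> R) (p q : T -> R) :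
  continuous2 f -> continuous p -> continuous q -> continuous (fun z => f (p z) (q z)).
Proof. by move=> cf cp cq; exact: (continuous_compose cf (continuous_pairing cp cq)). Qed.

Lemma continuous_proj1 (R : realType) : continuous (fun z : R * R => z.1).
Proof. by move=> z; exact: cvg_fst. Qed.

Lemma continuous_proj2 (R : realType) : continuous (fun z : R * R => z.2).
Proof. by move=> z; exact: cvg_snd. Qed.

Ltac continuity := repeat lazymatch goal with
  | |- forall x, continuous_at x (fun z => @?f z + @?g z) => apply: (@continuous_add _ _ f g)
  | |- forall x, continuous_at x (fun z => @?f z * @?g z) => apply: (@continuous_mul _ _ f g)
  | |- forall x, continuous_at x (fun z => - @?f z) => apply: (@continuous_opp _ _ f)
  | |- forall x, continuous_at x (fun z => @?f z ^+ ?n) => apply: (@continuous_pow _ _ f n)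
  | |- forall x, continuous_at x (fun z => `|@?f z|) => apply: (@continuous_norm_of _ _ f)
  | |- forall x, continuous_at x (fun z => expR (@?f z)) => apply: (@continuous_exp_of _ _ f)
  | |- forall x, continuous_at x (fun z => Num.max (@?f z) (@?g z)) =>
      apply: (@continuous_max_of _ _ f g)
  | |- forall x, continuous_at x (fun z => Num.min (@?f z) (@?g z)) =>
      apply: (@continuous_min_of _ _ f g)
  | |- forall x, continuous_at x (fun z => z) => exact: continuous_var
  | |- forall x, continuous_at x (fun z => z.1) => exact: continuous_proj1
  | |- forall x, continuous_at x (fun z => z.2) => exact: continuous_proj2
  | |- _ =>
      first [exact: continuous_const|assumption|(apply: continuous2_comp; [eassumption| |])]
  end.

Ltac derivation := apply: is_derive_eq; rewrite /GRing.scale/=.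

Section Calculus.
Variable R : realType.
Implicit Types (f g : R -> R) (a b c d t x : R).

(** Mean value theorem for [g - f]. Derivatives are assumed only in the open interval, because time
    derivatives exist only inside a strip. *)
Lemma le_deriv f g (df dg : R -> R) a b : a <= b -> continuous f -> continuous g ->
  (forall x, a < x < b -> is_derive x 1 f (df x)) ->
  (forall x, a < x < b -> is_derive x 1 g (dg x)) ->
  (forall x, a < x < b -> df x <= dg x) -> f b - f a <= g b - g a.
Proof.
rewrite le_eqVlt => /predU1P[->|ab] cf cg hf hg h; first by rewrite !subrr.
have [||c cab] := @MVT R (fun x => g x - f x) (fun x => dg x - df x) a b ab.
- by move=> x; rewrite in_itv/= => xab; apply: is_derive_sub; [exact: hg|exact: hf].
- by apply: continuous_subspaceT; apply: continuous_add => //; exact: continuous_opp.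
move=> e; have cab' : a < c < b by move: cab; rewrite in_itv.
have : 0 <= (dg c - df c) * (b - a).
  by rewrite mulr_ge0// subr_ge0 ?h// ltW.
by rewrite -e; lra.
Qed.

Lemma norm_le_deriv f g (df dg : R -> R) a b : a <= b ->
  continuous f -> continuous g ->
  (forall x, a < x < b -> is_derive x 1 f (df x)) ->
  (forall x, a < x < b -> is_derive x 1 g (dg x)) ->
  (forall x, a < x < b -> `|df x| <= dg x) -> `|f b - f a| <= g b - g a.
Proof.
move=> ab cf cg hf hg h; rewrite ler_norml; apply/andP; split.
  have : - f b - - f a <= g b - g a.
    apply: (@le_deriv (fun x => - f x) g (fun x => - df x) dg) => //.
    - exact: continuous_opp.
    - by move=> x xab; apply: is_derive_opp; exact: hf.
    - by move=> x xab; have := h x xab; rewrite ler_norml => /andP[]; lra.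
  lra.
apply: (@le_deriv f g df dg) => // x xab.
by rewrite (le_trans (ler_norm _))// h.
Qed.

Lemma deriv_eps f t d : is_derive t 1 f d -> forall e, 0 < e ->
  exists2 dl, 0 < dl & forall h, h != 0 -> `|h| < dl ->
    `|h^-1 * (f (h + t) - f t) - d| < e.
Proof.
move=> [df dv] e e0.
have : (fun h => h^-1 *: ((f \o shift t) (h *: 1) - f t)) @ 0^' --> d.
  by rewrite -dv; exact: df.
move=> /cvgrPdist_lt /(_ _ e0) [dl /= dl0 H]; exists dl => // h h0 hdl.
rewrite distrC.
have := H h; rewrite /ball_/= sub0r normrN => /(_ hdl h0).
by rewrite [h%:A]mulr1.
Qed.

(** One-sided, for use at a first touching time, where only earlier times can be compared. *)
Lemma deriv_ge0_left f t d dl : is_derive t 1 f d -> 0 < dl ->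
  (forall s, t - dl < s < t -> f s <= f t) -> 0 <= d.
Proof.
move=> df dl0 H; rewrite leNgt; apply/negP => d0.
have [|e e0 He] := deriv_eps df (e := - d); first lra.
pose m := Num.min e dl / 2.
have m0 : 0 < m by rewrite /m divr_gt0// lt_min e0 dl0.
have me : m < e /\ m < dl.
  by split; rewrite /m ltr_pdivrMr// gt_min; apply/orP; [left|right]; lra.
have := He (- m); rewrite oppr_eq0 gt_eqF// normrN gtr0_norm// => /(_ isT me.1).
have : f (- m + t) <= f t by apply: H; lra.
move=> fm; rewrite ltr_norml => /andP[_].
have : 0 <= (- m)^-1 * (f (- m + t) - f t).
  by rewrite mulr_le0// ?subr_le0// invr_le0; lra.
lra.
Qed.

Lemma deriv_le0_right f t d dl : is_derive t 1 f d -> 0 < dl ->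
  (forall s, t < s < t + dl -> f s <= f t) -> d <= 0.
Proof.
move=> df dl0 H; rewrite leNgt; apply/negP => d0.
have [e e0 He] := deriv_eps df d0.
pose m := Num.min e dl / 2.
have m0 : 0 < m by rewrite /m divr_gt0// lt_min e0 dl0.
have me : m < e /\ m < dl.
  by split; rewrite /m ltr_pdivrMr// gt_min; apply/orP; [left|right]; lra.
have := He m; rewrite gt_eqF// gtr0_norm// => /(_ isT me.1).
have : f (m + t) <= f t by apply: H; lra.
move=> fm; rewrite ltr_norml => /andP[+ _].
have : m^-1 * (f (m + t) - f t) <= 0.
  by rewrite mulr_ge0_le0// ?subr_le0// invr_ge0; lra.
lra.
Qed.

Lemma deriv_local_max f t d dl : is_derive t 1 f d -> 0 < dl ->
  (forall s, `|s - t| < dl -> f s <= f t) -> d = 0.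
Proof.
move=> df dl0 H; apply/eqP; rewrite eq_le; apply/andP; split.
  by apply: (deriv_le0_right df dl0) => s hs; apply: H; rewrite ltr_norml; lra.
by apply: (deriv_ge0_left df dl0) => s hs; apply: H; rewrite ltr_norml; lra.
Qed.

(** The endpoints come in either order. The bound on [c - a] makes the intermediate point converge
    to [a] as [b] does. *)
Lemma MVT_between f (df : R -> R) a b :
  (forall x, is_derive x 1 f (df x)) ->
  exists c, [/\ Num.min a b <= c <= Num.max a b, `|c - a| <= `|b - a| &
    f b - f a = df c * (b - a)].
Proof.
move=> hf; have cf : continuous f.
  move=> x; apply/differentiable_continuous/derivable1_diffP.
  by case: (hf x).
have [ab|ba] := leP a b.
  have [c cab e] := MVT_segment ab (fun x _ => hf x) (continuous_subspaceT cf).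
  exists c; move: cab; rewrite in_itv/= => /andP[h1 h2]; split => //.
    by rewrite h1.
  by rewrite !ger0_norm; lra.
have [c cab e] := MVT_segment (ltW ba) (fun x _ => hf x) (continuous_subspaceT cf).
exists c; move: cab; rewrite in_itv/= => /andP[h1 h2]; split.
- by rewrite h1.
- by rewrite !ler0_norm; lra.
- by rewrite -opprB e; ring.
Qed.

Lemma lipschitz_between f (df : R -> R) a b C :
  (forall x, is_derive x 1 f (df x)) ->
  (forall x, Num.min a b <= x <= Num.max a b -> `|df x| <= C) ->
  `|f b - f a| <= C * `|b - a|.
Proof.
move=> hf hC; have [c [c1 c2 ->]] := MVT_between a b hf.
by rewrite normrM ler_wpM2r// hC.
Qed.

(** A time derivative of [F] is required only at the fixed position [p t]: the increment in position
    is taken at the moving time [s], where the mean value theorem and the joint continuity of [fx]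
    give its limit. *)
Lemma deriv_along (fx : R -> R -> R) (p : R -> R) (F : R -> R -> R) t dp ft :
  (forall x s, is_derive x 1 (F^~ s) (fx x s)) -> continuous2 fx ->
  is_derive t 1 p dp -> is_derive t 1 (F (p t)) ft ->
  is_derive t 1 (fun s => F (p s) s) (fx (p t) t * dp + ft).
Proof.
move=> hF cfx hp hft.
have [|c hc] := @choice R R (fun s y => `|y - p t| <= `|p s - p t| /\
    F (p s) s - F (p t) s = fx y s * (p s - p t)).
  move=> s; have [c [_ h1 h2]] := MVT_between (p t) (p s) (hF^~ s).
  by exists c.
have cp : p s @[s --> t] --> p t.
  by apply/differentiable_continuous/derivable1_diffP; case: hp.
have cc : c s @[s --> t] --> p t.
  apply/cvgrPdist_lt => e e0; move/cvgrPdist_lt : cp => /(_ _ e0).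
  apply: filterS => s; rewrite distrC => h; rewrite distrC.
  exact: le_lt_trans (hc s).1 h.
have ccs : fx (c s) s @[s --> t] --> fx (p t) t.
  exact: (@cvg_comp _ _ _ (fun s => (c s, s)) (fun z => fx z.1 z.2) (nbhs t)
    (nbhs (p t, t)) (nbhs (fx (p t) t)) (cvg_pair cc cvg_id) (cfx (p t, t))).
have shiftc : (fun h : R => h + t) @ 0^' --> t.
  have : (fun h : R => h + t) @ (0 : R) --> 0 + t.
    exact: (@continuous_add R R id (fun=> t) (@continuous_var R) (@continuous_const R R t) 0).
  by rewrite add0r; exact: cvg_within_filter.
have h1 : is_derive t 1 (fun s => F (p s) s - F (p t) s) (fx (p t) t * dp).
  have lim1 : (fun h => h^-1 *: (((fun s => F (p s) s - F (p t) s) \o shift t)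
      (h *: 1) - (F (p t) t - F (p t) t))) @ 0^' --> fx (p t) t * dp.
    have -> : (fun h => h^-1 *: (((fun s => F (p s) s - F (p t) s) \o shift t)
      (h *: 1) - (F (p t) t - F (p t) t))) =
      (fun h => fx (c (h + t)) (h + t) * (h^-1 *: ((p \o shift t) (h *: 1) - p t))).
      apply/funext => h; rewrite /= [h%:A]mulr1 subrr subr0 (hc _).2.
      by rewrite /GRing.scale/=; ring.
    apply: cvgM; first exact: (cvg_comp _ _ shiftc ccs).
    by case: hp => hp1 <-; exact: hp1.
  split; first by apply/cvg_ex; exists (fx (p t) t * dp).
  exact: (cvg_lim _ lim1).
have -> : (fun s => F (p s) s) = (fun s => (F (p s) s - F (p t) s) + F (p t) s).
  by apply/funext => s; rewrite subrK.
exact: is_derive_add.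
Qed.

End Calculus.

(** * Compactness: bounds on rectangles and first touching times *)

Section Compactness.
Variable R : realType.
Implicit Types (f : R -> R -> R) (a b c d t x : R).

Lemma bounded2 f a b c d : continuous2 f -> exists2 B, 0 < B &
  forall x t, a <= x <= b -> c <= t <= d -> `|f x t| <= B.
Proof.
move=> cf.
have cA : compact (`[a, b]%classic `*` `[c, d]%classic).
  by apply: compact_setX; exact: segment_compact.
have /continuous_subspaceT cg := continuous_norm_of cf.
have [A0|/set0P/negP/negPn/eqP A0] :=
    pselect (`[a, b]%classic `*` `[c, d]%classic !=set0); last first.
  exists 1 => // x t xab tcd.
  have : (`[a, b]%classic `*` `[c, d]%classic) (x, t) by split; rewrite /= in_itv.
  by rewrite A0.
have [[x0 t0] _ H] := compact_EVT_max A0 cA (cg _).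
exists (`|f x0 t0| + 1); first by rewrite ltr_wpDl.
move=> x t xab tcd.
have := H (x, t); rewrite inE => /(_ _)/le_trans -> //; last by rewrite lerDl.
Qed.

Lemma le_left_limit (g : R -> R) c t K : continuous g -> c < t ->
  (forall s, c <= s < t -> g s <= K) -> g t <= K.
Proof.
move=> cg ct H; rewrite leNgt; apply/negP => Kg.
have := cg t => /cvgrPdist_lt /(_ (g t - K)); rewrite subr_gt0 => /(_ Kg).
move=> [e /= e0 He].
pose m := Num.min e (t - c) / 2.
have m0 : 0 < m by rewrite /m divr_gt0// lt_min e0 subr_gt0.
have me : m < e /\ m < t - c.
  by split; rewrite /m ltr_pdivrMr// gt_min; apply/orP; [left|right]; lra.
have := He (t - m); rewrite /ball_/= subKr gtr0_norm// => /(_ me.1).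
have := H (t - m); rewrite ltr_norml => h1 /andP[_].
have : g (t - m) <= K by apply: h1; lra.
lra.
Qed.

Lemma pos_near (g : R -> R) x : continuous g -> 0 < g x ->
  exists2 dl, 0 < dl & forall y, `|y - x| < dl -> 0 < g y.
Proof.
move=> cf fx; have := cf x => /cvgrPdist_lt /(_ _ fx) [dl /= dl0 H].
exists dl => // y hy; have := H y; rewrite /ball_/= distrC => /(_ hy).
by rewrite ltr_norml => /andP[_]; lra.
Qed.

(** The set where [f >= 1] is compact, so it has a point of least time, and continuity from earlier
    times forces equality there. That point is at once a spatial maximum and a first time, which is
    what replaces a characteristic. *)
Lemma first_touch f a b c d : continuous2 f -> (forall x, a <= x <= b -> f x c < 1) ->
  (forall x t, a <= x <= b -> c <= t <= d -> f x t < 1) \/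
  exists x t, [/\ a <= x <= b, c < t <= d, f x t = 1,
    forall y, a <= y <= b -> f y t <= 1 &
    forall y s, a <= y <= b -> c <= s < t -> f y s < 1].
Proof.
move=> cf H0.
have [H|H] := pselect (forall x t, a <= x <= b -> c <= t <= d -> f x t < 1);
  [by left|right].
pose S := (`[a, b]%classic `*` `[c, d]%classic) `&`
  ((fun z : R * R => f z.1 z.2) @^-1` [set y | 1 <= y]).
have cS : compact S.
  apply: compact_closedI.
    by apply: compact_setX; exact: segment_compact.
  by apply: (closed_comp (fun z _ => cf z)); exact: closed_ge.
have S0 : S !=set0.
  apply/set0P/negP => /eqP SE; apply: H => x t xab tcd; rewrite ltNge.
  apply/negP => h; have : S (x, t) by split => //; split; rewrite /= in_itv.
  by rewrite SE.
have cs2 : {within S, continuous (fun z : R * R => z.2)}.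
  by apply: continuous_subspaceT; exact: continuous_proj2.
have [[x t]] := compact_EVT_min S0 cS cs2.
rewrite inE => -[[/=]]; rewrite !in_itv/= => xab tcd f1 Hmin.
have lt1 y s : a <= y <= b -> c <= s < t -> f y s < 1.
  move=> yab /andP[s0 st]; rewrite ltNge; apply/negP => h.
  have : t <= s.
    apply: (Hmin (y, s)); rewrite inE; split => //; split; rewrite /= in_itv//=.
    by rewrite s0 (le_trans (ltW st))//; case/andP: tcd.
  by rewrite leNgt st.
have ct : c < t.
  rewrite lt_neqAle; case/andP: tcd => -> _; rewrite andbT; apply/eqP => ct.
  by have := H0 _ xab; rewrite ct ltNge f1.
have le1 y : a <= y <= b -> f y t <= 1.
  move=> yab; apply: (@le_left_limit (f y) c) => //.
    by apply: (continuous2_comp cf); [exact: continuous_const|exact: continuous_var].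
  by move=> s hs; exact/ltW/lt1.
exists x, t; split => //; first by rewrite ct; case/andP: tcd.
by apply/eqP; rewrite eq_le f1 le1.
Qed.

End Compactness.

(** * Gronwall inequality for families *)

Section Gronwall.
Variable R : realType.

Lemma le0_halving (y K : R) : (forall j, y <= K / 2 ^+ j) -> y <= 0.
Proof.
move=> H; rewrite leNgt; apply/negP => y0.
have K0 : 0 < K by have := H 0%N; rewrite expr0 divr1; exact: lt_le_trans.
have := archi_boundP (ltW (divr_gt0 K0 y0)).
set j := Num.bound _ => hj.
have := H j; rewrite leNgt => /negP; apply.
rewrite ltr_pdivrMr ?exprn_gt0// -ltr_pdivrMl// mulrC.
apply: lt_le_trans hj _; rewrite -natrX ler_nat; apply: ltnW; exact: ltn_expl.
Qed.

(** Each derivative is controlled by the supremum over the whole family, which need not be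
    differentiable. A uniform bound is improved instead: with the exponential rate [2 C], each
    integration in time gains a factor 1/2. *)
Lemma gronwall0 (J : set R) (n dn : R -> R -> R) (a b B C : R) : 0 < C ->
  (forall s, J s -> continuous (n s)) -> (forall s, J s -> n s a = 0) ->
  (forall s t, J s -> a < t < b -> is_derive t 1 (n s) (dn s t)) ->
  (forall s t, J s -> a <= t <= b -> `|n s t| <= B) ->
  (forall N t, a < t < b -> (forall s, J s -> `|n s t| <= N) ->
    forall s, J s -> `|dn s t| <= C * N) ->
  forall s t, J s -> a <= t <= b -> n s t = 0.
Proof.
move=> C0 cn na hd hB hC.
have key j : forall s t, J s -> a <= t <= b ->
    `|n s t| <= B / 2 ^+ j * expR (2 * C * (t - a)).
  elim: j => [|j IH] s t Js tab.
    have Bn := hB _ _ Js tab.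
    rewrite expr0 divr1 (le_trans Bn)// ler_peMr ?(le_trans _ Bn)//.
    rewrite -expR0 ler_expR; case/andP: tab => h _.
    by rewrite !mulr_ge0 ?subr_ge0// ltW.
  set N := B / 2 ^+ j in IH.
  have -> : B / 2 ^+ j.+1 = N / 2 by rewrite /N exprS invfM; ring.
  case/andP: (tab) => at' tb.
  pose g x := N / 2 * expR (2 * C * (x - a)).
  have : `|n s t - n s a| <= g t - g a.
    apply: (@norm_le_deriv R _ _ (dn s) (fun x => C * (N * expR (2 * C * (x - a)))))
      => //.
    - exact: cn.
    - by rewrite /g; continuity.
    - by move=> x xab; apply: hd => //; case/andP: xab => -> /lt_le_trans ->.
    - move=> x xab; rewrite /g; derivation; by field.
    - move=> x /andP[ax xt]; apply: hC => //.
        by rewrite ax (lt_le_trans xt).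
      by move=> s' Js'; apply: IH => //; rewrite ltW//= ltW// (lt_le_trans xt).
  rewrite na// subr0 => /le_trans; apply.
  rewrite /g gerBl subrr mulr0 expR0 mulr1 divr_ge0//.
  have := IH s a Js; rewrite subrr mulr0 expR0 mulr1 => h.
  by rewrite (le_trans _ (h _))// lexx (le_trans at').
move=> s t Js tab; apply/eqP; rewrite -normr_le0.
apply: (@le0_halving _ (B * expR (2 * C * (t - a)))) => j.
by rewrite (le_trans (key j s t Js tab))// mulrAC.
Qed.

End Gronwall.

(** * Antiderivatives of continuous functions *)

Section Antiderivative.
Variable R : realType.
Implicit Types (f : R -> R) (a b : R).

Lemma integrable_itv f a b : continuous f ->
  (LebesgueMeasure R).-integrable `[a, b] (EFin \o f).
Proof.
move=> cf; apply: continuous_compact_integrable; first exact: segment_compact.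
exact: continuous_subspaceT.
Qed.

(** Integrating from [a - 1] makes the primitive differentiable at [a] itself; freezing it to the
    left of [a] then gives continuity on the whole line. *)
Lemma antiderivative f a : continuous f -> exists F : R -> R,
  continuous F /\ forall t, a < t -> is_derive t 1 F (f t).
Proof.
move=> cf.
pose F y := \int[LebesgueMeasure R]_(x in `[a - 1, y]) f x.
have dF y : a - 1 < y -> is_derive y 1 F (f y).
  move=> ay; have yy : y < y + 1 by lra.
  have [h1 h2] := @continuous_FTC1_closed R f (a - 1) y (y + 1) yy
    (integrable_itv _ _ cf) ay (cf y).
  by split; [exact: h1|rewrite -derive1E].
exists (fun y => F (Num.max a y)); split.
  have cmx : continuous (fun y : R => Num.max a y) by continuity.
  move=> y; apply: (continuous_comp (cmx y)).
  apply/differentiable_continuous/derivable1_diffP.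
  have ay : a - 1 < Num.max a y by rewrite lt_max; apply/orP; left; lra.
  by case: (dF _ ay).
move=> t at'; apply: (@near_eq_is_derive _ _ _ F); last by apply: dF; lra.
by near=> s; rewrite max_r// ltW//; near: s; exact: lt_nbhsr.
Unshelve. all: by end_near. Qed.

End Antiderivative.

(** * Finite propagation *)

Section Vanishing.
Variables (R : realType) (m mx W g h : R -> R -> R) (rho tau : R).
Implicit Types x t r y s : R.
Hypotheses (cm : continuous2 m) (cmx : continuous2 mx) (cW : continuous2 W).
Hypotheses (cg : continuous2 g) (ch : continuous2 h).
Hypothesis dm : forall x t, is_derive x 1 (m^~ t) (mx x t).
Hypothesis dW : forall x t, is_derive x 1 (W^~ t) (h x t * m x t).
Hypothesis dtm : forall x t, 0 < t < tau ->
  is_derive t 1 (m x) (W x t * mx x t + g x t * m x t).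
Hypothesis W0 : forall r t, 0 <= t <= tau -> (forall y, y <= r -> m y t = 0) ->
  W r t = 0.

(* In the frame moving with the velocity at the single point rho - 1 the
   equation for m is controlled by m alone, because W_x = h m; hence the time
   step does not depend on how far to the left we look. *)
Lemma vanish_step (C0 : R) t0 t1 : 0 <= t0 -> t0 <= t1 -> t1 <= tau ->
  (forall t, t0 <= t <= t1 -> `|W (rho - 1) t| <= C0) -> C0 * (t1 - t0) <= 1 ->
  (forall x, x <= rho -> m x t0 = 0) ->
  forall x t, x <= rho -> t0 <= t <= t1 -> m x t = 0.
Proof.
(* The frame [q] follows the velocity at a point one unit inside the empty region; by the choice of
   the time step it moves by at most that unit. *)
move=> t00 t01 t1tau hC0 hdt m0; set r := rho - 1.
have cWr : continuous (fun t => - W r t) by continuity.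
have [Q [cQ dQ]] := antiderivative (-1) cWr.
pose q t := r + Q t - Q t0.
have dq t : t0 < t -> is_derive t 1 q (- W r t).
  move=> tt0; have dQt : is_derive t 1 Q (- W r t) by apply: dQ; lra.
  by rewrite /q; derivation; ring.
have cq : continuous q by rewrite /q; continuity.
have q0 : q t0 = r by rewrite /q; ring.
have qr t : t0 <= t <= t1 -> `|q t - r| <= 1.
  move=> /andP[tt0 tt1].
  have C00 : 0 <= C0 by apply: le_trans (hC0 t0 _); rewrite ?normr_ge0// lexx.
  have : `|q t - q t0| <= C0 * t - C0 * t0.
    apply: (@norm_le_deriv _ q (fun t => C0 * t) (fun t => - W r t) (fun=> C0)).
    - by [].
    - by [].
    - by continuity.
    - by move=> s /andP[ss0 _]; exact: dq.
    - by move=> s _; derivation; ring.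
    - by move=> s sI; rewrite normrN hC0//; lra.
  rewrite q0 -mulrBr => /le_trans; apply; apply: le_trans hdt.
  by rewrite ler_wpM2l//; lra.
(* With [x = q t - s], the condition [s >= -1] at time [t0] is exactly [x <= rho]. The cut-off [K]
   keeps the constants finite, and Gronwall gives zero whatever their size. *)
have main K : 1 <= K -> forall s t, -1 <= s <= K -> t0 <= t <= t1 ->
    m (q t - s) t = 0.
  move=> K1.
  have [B B0 hB] := bounded2 (r - 1 - K) (r + 2) t0 t1 cm.
  have [C1 C10 hC1] := bounded2 (r - 1 - K) (r + 2) t0 t1 cmx.
  have [C2 C20 hC2] := bounded2 (r - 1 - K) (r + 2) t0 t1 ch.
  have [C3 C30 hC3] := bounded2 (r - 1 - K) (r + 2) t0 t1 cg.
  have zone s t : -1 <= s <= K -> t0 <= t <= t1 ->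
      r - 1 - K <= q t - s <= r + 2.
    by move=> hs /qr; rewrite ler_norml; lra.
  pose C := C2 * (1 + K) * C1 + C3.
  have C0' : 0 < C by rewrite addr_gt0// !mulr_gt0//; lra.
  pose dn s t := mx (q t - s) t * (- W r t) +
    (W (q t - s) t * mx (q t - s) t + g (q t - s) t * m (q t - s) t).
  apply: (@gronwall0 R [set s | -1 <= s <= K] (fun s t => m (q t - s) t) dn
    t0 t1 B C C0').
  - by move=> s _; apply: (continuous2_comp cm); continuity.
  - by move=> s /= hs; apply: m0; rewrite q0 /r; lra.
  - move=> s t /= hs ht; have dqt : is_derive t 1 q (- W r t) by apply: dq; lra.
    apply: (@deriv_along R mx (fun t => q t - s) m t (- W r t)) => //.
    + by derivation; ring.
    + by apply: dtm; lra.
  - by move=> s t hs ht; apply: hB; [exact: zone|].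
  - move=> N t ht' hN s hs; have ht : t0 <= t <= t1 by lra.
    have Zs := zone s t hs ht.
    have dWle : `|W (q t - s) t - W r t| <= C2 * N * `|q t - s - r|.
      apply: (lipschitz_between (fun x => dW x t)) => y hy.
      have hqr := qr t ht; move: hqr; rewrite ler_norml => hqr.
      (* Every point between [r] and [q t - s] belongs to the family: the end [r] has index
         [q t - r], which lies in [[-1, 1]], and [1 <= K]. *)
      have Jy : -1 <= q t - y <= K.
        move: hs hy => /=; rewrite ge_min le_max.
        move=> /andP[s1 s2] /andP[/orP[] h1 /orP[] h2]; clear -s1 s2 h1 h2 hqr K1; lra.
      have := hN (q t - y) Jy; rewrite subKr => Ny.
      rewrite normrM ler_pM// hC2//.
      by have := zone _ _ Jy ht; rewrite subKr.
    have N0 : 0 <= N by apply: le_trans (hN s hs).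
    have hk : `|q t - s - r| <= 1 + K.
      have := qr t ht; move: hs => /=; rewrite !ler_norml; lra.
    have -> : dn s t = (W (q t - s) t - W r t) * mx (q t - s) t +
        g (q t - s) t * m (q t - s) t by rewrite /dn; ring.
    rewrite (le_trans (ler_normD _ _))// !normrM /C mulrDl lerD//.
      have -> : C2 * (1 + K) * C1 * N = C2 * N * (1 + K) * C1 by ring.
      rewrite ler_pM ?hC1//; apply: le_trans dWle _.
      by rewrite ler_wpM2l// mulr_ge0// ltW.
    by rewrite ler_pM ?hC3 ?hN.
have zero t x : t0 <= t <= t1 -> x <= q t + 1 -> m x t = 0.
  move=> ht hx.
  have := main (1 + `|q t - x|) _ (q t - x) t; rewrite subKr; apply => //.
    by rewrite lerDl.
  have := ler_norm (q t - x); lra.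
(* As [|q t - r| <= 1], the empty region [x <= q t + 1] always contains [x <= r]; so the velocity at
   [r] is zero, the frame has not moved, and the region is still [x <= rho]. *)
have Wr0 t : t0 <= t <= t1 -> W r t = 0.
  move=> ht; apply: W0; first lra.
  by move=> y hy; apply: zero => //; have := qr t ht; rewrite ler_norml; lra.
have qE t : t0 <= t <= t1 -> q t = r.
  move=> ht; apply/eqP; rewrite -subr_eq0 -normr_le0 -q0.
  have -> : 0 = (0 : R) - 0 by rewrite subr0.
  apply: (@norm_le_deriv _ q (fun=> 0) (fun t => - W r t) (fun=> 0) t0 t).
  - by case/andP: ht.
  - exact: cq.
  - exact: continuous_const.
  - by move=> s /andP[hs _]; exact: dq.
  - by move=> s hs; rewrite Wr0 ?normrN ?normr0//; lra.
by move=> x t hx ht; apply: (zero t) => //; rewrite qE// /r subrK.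
Qed.

(** A step loses nothing in [rho], so steps of the fixed length [1 / C] can be iterated, with [C]
    bounding the velocity at the single point [rho - 1] over the whole strip. *)
Lemma vanish_left : (forall x, x <= rho -> m x 0 = 0) ->
  forall x t, x <= rho -> 0 <= t <= tau -> m x t = 0.
Proof.
move=> m0.
have [C C0 hC] := bounded2 (rho - 1) (rho - 1) 0 tau cW.
have key (n : nat) : forall x t, x <= rho -> 0 <= t <= tau -> C * t <= n%:R ->
    m x t = 0.
  elim: n => [|n IH] x t hx ht htn.
    have -> : t = 0; last exact: m0.
    apply/eqP; rewrite eq_le; case/andP: ht => -> _; rewrite andbT.
    by rewrite -(ler_pM2l C0) mulr0.
  have [hle|hlt] := leP (C * t) n%:R; first exact: IH.
  have hs : C * (n%:R / C) = n%:R by rewrite mulrC divfK// gt_eqF.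
  have nC : 0 <= n%:R / C by rewrite divr_ge0// ltW.
  have nt : n%:R / C <= t by rewrite ler_pdivrMr// mulrC ltW.
  apply: (@vanish_step C (n%:R / C) t) => //.
  - by case/andP: ht.
  - by move=> s hs'; apply: hC; rewrite ?lexx//; lra.
  - by rewrite mulrBr hs lerBlDr addrC -natr1 in htn *; lra.
  - by move=> y hy; apply: IH; rewrite ?hs//; lra.
  - by rewrite nt lexx.
move=> x t hx ht; apply: (key (Num.bound (C * t))) => //.
by apply/ltW/archi_boundP; case/andP: ht => t0 _; rewrite mulr_ge0// ltW.
Qed.

End Vanishing.

(** Reflection [x -> - x], under which [mx] and [W] change sign whereas [g] and [h] do not. *)
Lemma vanish_right (R : realType) (m mx W g h : R -> R -> R) (rho tau : R) :
  continuous2 m -> continuous2 mx -> continuous2 W -> continuous2 g -> continuous2 h ->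
  (forall x t : R, is_derive x 1 (m^~ t) (mx x t)) ->
  (forall x t : R, is_derive x 1 (W^~ t) (h x t * m x t)) ->
  (forall x t : R, 0 < t < tau ->
    is_derive t 1 (m x) (W x t * mx x t + g x t * m x t)) ->
  (forall r t : R, 0 <= t <= tau -> (forall y, r <= y -> m y t = 0) -> W r t = 0) ->
  (forall x, rho <= x -> m x 0 = 0) ->
  forall x t : R, rho <= x -> 0 <= t <= tau -> m x t = 0.
Proof.
move=> cm cmx cW cg ch dm dW dtm W0 m0 x t hx ht.
have cop : continuous (fun z : R * R => - z.1) by continuity.
have dop (f : R -> R) (f' y : R) : is_derive (- y) 1 f f' ->
    is_derive y 1 (fun z : R => f (- z)) (- f').
  move=> df; apply: (is_derive_eq (is_derive_compose (is_derive_opp (is_derive_var y)) df)); ring.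
rewrite -[x]opprK.
apply: (@vanish_left R (fun x t => m (- x) t) (fun x t => - mx (- x) t)
  (fun x t => - W (- x) t) (fun x t => g (- x) t) (fun x t => h (- x) t)
  (- rho) tau).
- exact: (continuous2_comp cm cop (@continuous_proj2 R)).
- exact: (continuous_opp (continuous2_comp cmx cop (@continuous_proj2 R))).
- exact: (continuous_opp (continuous2_comp cW cop (@continuous_proj2 R))).
- exact: (continuous2_comp cg cop (@continuous_proj2 R)).
- exact: (continuous2_comp ch cop (@continuous_proj2 R)).
- by move=> y s; exact: dop.
- by move=> y s; rewrite -[h _ _ * _]opprK; apply: is_derive_opp; exact: dop.
- by move=> y s hs; rewrite mulrNN; exact: dtm.
- move=> r s hs H; rewrite W0 ?oppr0// => y hy.
  by rewrite -[y]opprK H// lerNl.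
- by move=> y hy; apply: m0; lra.
- by lra.
- by [].
Qed.

(** * Integrals over segments *)

Definition intg (R : realType) (a b : R) (f : R -> R) : R :=
  \int[LebesgueMeasure R]_(x in `[a, b]) f x.

Section Integrals.
Variable R : realType.
Implicit Types (f g : R -> R) (a b c d x t : R).

Lemma eq_intg f g a b : (forall x, a <= x <= b -> f x = g x) ->
  intg a b f = intg a b g.
Proof. by move=> fg; apply: eq_Rintegral => x; rewrite inE/= in_itv/=; exact: fg. Qed.

Lemma intgD f g a b : continuous f -> continuous g ->
  intg a b (fun x => f x + g x) = intg a b f + intg a b g.
Proof. by move=> cf cg; apply: RintegralD => //; exact: integrable_itv. Qed.

Lemma intgZ (k : R) f a b : continuous f ->
  intg a b (fun x => k * f x) = k * intg a b f.
Proof. by move=> cf; apply: RintegralZl => //; exact: integrable_itv. Qed.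

Lemma intgN f a b : continuous f -> intg a b (fun x => - f x) = - intg a b f.
Proof.
by move=> cf; rewrite -mulN1r -intgZ//; apply: eq_intg => x _; rewrite mulN1r.
Qed.

Lemma intg_const (k : R) a b : a <= b -> intg a b (fun=> k) = k * (b - a).
Proof.
move=> ab; rewrite /intg Rintegral_cst//.
have -> : LebesgueMeasure R `[a, b]%classic = lebesgue_measure `[a, b]%classic by [].
rewrite lebesgue_measure_itv/= lte_fin.
by move: ab; rewrite le_eqVlt => /predU1P[->|->]//; rewrite ltxx subrr.
Qed.

Lemma le_intg f g a b : continuous f -> continuous g ->
  (forall x, a <= x <= b -> f x <= g x) -> intg a b f <= intg a b g.
Proof.
by move=> cf cg fg; apply: le_Rintegral => //; exact: integrable_itv.
Qed.

Lemma intg_ge0 f a b : (forall x, a <= x <= b -> 0 <= f x) -> 0 <= intg a b f.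
Proof. by move=> h; apply: Rintegral_ge0 => x; rewrite /= in_itv/=; exact: h. Qed.

Lemma le_norm_intg f a b : continuous f ->
  `|intg a b f| <= intg a b (fun x => `|f x|).
Proof. by move=> cf; apply: le_normr_Rintegral => //; exact: integrable_itv. Qed.

Lemma intg_deriv (F : R -> R) f a b : a <= b -> continuous f ->
  (forall x, a <= x <= b -> is_derive x 1 F (f x)) -> intg a b f = F b - F a.
Proof.
rewrite le_eqVlt => /predU1P[->|ab] cf dF.
  by rewrite /intg set_itv1 Rintegral_set1 subrr.
have cF x : a <= x <= b -> F @ x --> F x.
  move=> hx; apply/differentiable_continuous/derivable1_diffP.
  by case: (dF x hx).
rewrite /intg /Rintegral (@continuous_FTC2 R f F)//.
- exact: continuous_subspaceT.
- split.
  + by move=> x; rewrite in_itv/= => hx; case: (dF x _) => //; rewrite !ltW; case/andP: hx.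
  + by apply: cvg_at_right_filter; apply: cF; rewrite lexx ltW.
  + by apply: cvg_at_left_filter; apply: cF; rewrite lexx ltW.
- move=> x; rewrite in_itv/= => hx; rewrite derive1E.
  by case: (dF x _) => //; rewrite !ltW; case/andP: hx.
Qed.

Lemma intg_cat f a b c : a <= b -> b <= c -> continuous f ->
  intg a c f = intg a b f + intg b c f.
Proof.
move=> ab bc cf; have [F [_ dF]] := antiderivative (a - 1) cf.
have h u v : a <= u -> u <= v -> intg u v f = F v - F u.
  by move=> au uv; apply: intg_deriv => // x hx; apply: dF; lra.
by rewrite !h//; [ring|lra].
Qed.

(** Dominated differentiation; a constant bound of [ft] on the rectangle is the dominating
    function. *)
Lemma deriv_intg (f ft : R -> R -> R) a b c d : continuous2 f -> continuous2 ft ->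
  (forall x t, c < t < d -> is_derive t 1 (f x) (ft x t)) ->
  forall t, c < t < d ->
    is_derive t 1 (fun t => intg a b (f^~ t)) (intg a b (ft^~ t)).
Proof.
move=> cf cft dft t tcd.
have [B B0 hB] := bounded2 a b c d cft.
have d1E x s : c < s < d -> partial1of2 (fun s y => f y s) s x = ft x s.
  move=> hs; rewrite partial1of2E.
  by case: (dft x s hs).
have It : `]c, d[%classic t by rewrite /= in_itv.
have intf x : `]c, d[%classic x ->
    (LebesgueMeasure R).-integrable `[a, b] (EFin \o (fun y => f y x)).
  by move=> _; apply: integrable_itv; apply: (continuous2_comp cf); continuity.
have derf1 s y : `]c, d[%classic s -> `[a, b]%classic y ->
    derivable (fun s => f y s) s 1.
  by rewrite /= in_itv/= => hs _; case: (dft y s hs).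
have iB : (LebesgueMeasure R).-integrable `[a, b] (EFin \o (fun=> B)).
  by apply: integrable_itv; continuity.
have hub s y : `]c, d[%classic s -> `[a, b]%classic y ->
    `|partial1of2 (fun s y => f y s) s y| <= (fun=> B) y.
  rewrite /= !in_itv/= => hs hy; rewrite d1E//; apply: hB => //.
  by rewrite !ltW; case/andP: hs.
have mI : measurable (`[a, b]%classic : set (measurableTypeR R)) by [].
have B0' (y : measurableTypeR R) : 0 <= (fun=> B) y by rewrite ltW.
split.
  exact: (derivable_under_integral mI It intf derf1 B0' iB hub).
rewrite -derive1E.
have := differentiation_under_integral mI It intf derf1 B0' iB hub.
rewrite /intg => ->; apply: eq_Rintegral => y _.
exact: d1E.
Qed.

Lemma continuous_intg (f : R -> R -> R) a b : continuous2 f ->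
  continuous (fun t => intg a b (f^~ t)).
Proof.
move=> cf t.
have [B B0 hB] := bounded2 a b (t - 1) (t + 1) cf.
apply: (@continuity_under_integral R _ (measurableTypeR R) (LebesgueMeasure R)
  (fun s y => f y s) `[a, b]%classic _ (t - 1) (t + 1) _ _ (fun=> B)) => //.
- by move=> x _; apply: integrable_itv; apply: (continuous2_comp cf); continuity.
- by apply: aeW => y _ s _; apply: (continuous2_comp cf); continuity.
- by apply: integrable_itv; continuity.
- move=> s /=; rewrite in_itv/= => hs; apply: aeW => y /=; rewrite in_itv/= => hy.
  by apply: hB => //; rewrite !ltW; case/andP: hs.
- by rewrite inE/= in_itv/=; apply/andP; split; lra.
Qed.

End Integrals.

(** * A priori estimates *)

(* A solution on the time strip [0, tau]; freezing time outside [0, tau] makes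
   all the functions continuous on the whole plane, so time derivatives are only
   required inside the strip. *)
Record strip (R : realType) (tau L : R) (m mx u ux : R -> R -> R) : Prop := Strip {
  strip_m : continuous2 m; strip_mx : continuous2 mx;
  strip_u : continuous2 u; strip_ux : continuous2 ux;
  strip_dm : forall x t : R, is_derive x 1 (m^~ t) (mx x t);
  strip_du : forall x t : R, is_derive x 1 (u^~ t) (ux x t);
  strip_dux : forall x t : R, is_derive x 1 (ux^~ t) (u x t - m x t);
  strip_dtm : forall x t : R, 0 < t < tau -> is_derive t 1 (m x)
    (- ((u x t ^+ 2 - ux x t ^+ 2) * mx x t) - 2 * ux x t * m x t ^+ 2);
  strip_supp : forall x t : R, L <= `|x| -> m x t = 0;
  strip_left : forall x t : R, x <= - L -> u x t = ux x t;
  strip_right : forall x t : R, L <= x -> u x t = - ux x t }.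

Section Strip.
Variables (R : realType) (tau L : R) (m mx u ux : R -> R -> R).
Hypothesis L0 : 0 < L.
Hypothesis S : strip tau L m mx u ux.
Implicit Types x t y s e B : R.

Let V x t := u x t ^+ 2 - ux x t ^+ 2.
Let mt x t := - (V x t * mx x t) - 2 * ux x t * m x t ^+ 2.
Let mass t := intg (- L) L (fun x => `|m x t|).

Let cm : continuous2 m := strip_m S.
Let cmx : continuous2 mx := strip_mx S.
Let cu : continuous2 u := strip_u S.
Let cux : continuous2 ux := strip_ux S.
Let dm := strip_dm S.
Let du := strip_du S.
Let dux := strip_dux S.

Let cVel : continuous2 V.
Proof. by rewrite /continuous2 /V; continuity. Qed.

Let cmt : continuous2 mt.
Proof. by rewrite /continuous2 /mt; continuity. Qed.

Let ctx (f : R -> R -> R) t : continuous2 f -> continuous (f^~ t).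
Proof. by move=> cf; apply: (continuous2_comp cf); continuity. Qed.

Let dV x t : is_derive x 1 (V^~ t) (2 * ux x t * m x t).
Proof.
have := du x t; have := dux x t => d2 d1.
by rewrite /V; derivation; ring.
Qed.

(** V factors as [(u + ux) * (u - ux)], and one factor vanishes at each end. *)
Let V_edge t : V (- L) t = 0 /\ V L t = 0.
Proof.
rewrite /V (strip_left S) ?lexx// (strip_right S (x := L)) ?lexx//.
by rewrite sqrrN !subrr.
Qed.

(* The renormalised density phi(m) = sqrt (m^2 + e^2) satisfies
   phi_t + (V phi)_x = 2 ux m e^2 / phi, whose right-hand side is O(e^2). *)
Lemma deriv_intg_sqrt e t B : 0 < e -> 0 < t < tau ->
  (forall x, - L <= x <= L -> `|ux x t| <= B) ->
  exists2 d, is_derive t 1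
    (fun t => intg (- L) L (fun x => Num.sqrt (m x t ^+ 2 + e ^+ 2))) d &
    d <= 4 * B * L * e ^+ 2.
Proof.
move=> e0 ht hB.
pose phi x t : R := Num.sqrt (m x t ^+ 2 + e ^+ 2).
have pos x s : 0 < m x s ^+ 2 + e ^+ 2.
  by rewrite ltr_wpDl ?sqr_ge0 ?exprn_gt0.
have phi0 x s : 0 < phi x s by rewrite sqrtr_gt0.
have phi2 x s : phi x s ^+ 2 = m x s ^+ 2 + e ^+ 2 by rewrite sqr_sqrtr// ltW.
have cphi : continuous2 phi.
  by rewrite /continuous2 /phi; apply: continuous_sqrt_of; continuity.
have dsq (f : R -> R) (f' z : R) : 0 < f z ^+ 2 + e ^+ 2 -> is_derive z 1 f f' ->
    is_derive z 1 (fun y => Num.sqrt (f y ^+ 2 + e ^+ 2))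
      (f z * f' / Num.sqrt (f z ^+ 2 + e ^+ 2)).
  move=> fz df; have dg : is_derive z 1 (fun y => f y ^+ 2 + e ^+ 2) (2 * f z * f').
    by derivation; ring.
  apply: (is_derive_eq (is_derive_compose dg (is_derive1_sqrt fz))).
  by rewrite /= invfM; field; rewrite gt_eqF// sqrtr_gt0.
pose phit x t := m x t * mt x t / phi x t.
have cphiV : continuous (fun z : R * R => (phi z.1 z.2)^-1).
  by apply: continuous_inv_of => // z; rewrite gt_eqF.
have cphit : continuous2 phit by rewrite /continuous2 /phit; continuity.
exists (intg (- L) L (phit^~ t)).
  apply: (@deriv_intg R phi phit (- L) L 0 tau) => // x s hs.
  by apply: dsq => //; exact: (strip_dtm S).
(* The source term. The flux [V phi] has x-derivative [psi - phit] and vanishes at both ends, so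
   [phit] and [psi] have the same integral. *)
pose psi x := 2 * ux x t * m x t * e ^+ 2 / phi x t.
have cphiVt : continuous (fun x => (phi x t)^-1).
  by apply: continuous_inv_of => [z|]; [rewrite gt_eqF|exact: ctx].
have cpsi : continuous psi by rewrite /psi; continuity.
have cflux : continuous (fun x => psi x - phit x t).
  by have cp : continuous (phit^~ t) := ctx cphit; continuity.
have dflux x : is_derive x 1 (fun x => V x t * phi x t) (psi x - phit x t).
  have dphi : is_derive x 1 (phi^~ t) (m x t * mx x t / phi x t).
    by apply: dsq => //; exact: dm.
  have dVx := dV x t; apply: (is_derive_eq (is_derive_mul dVx dphi)).
  rewrite /psi /phit /mt; have -> : e ^+ 2 = phi x t ^+ 2 - m x t ^+ 2.
    by rewrite phi2; ring.
  by field; rewrite gt_eqF.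
have LL : - L <= L by rewrite ge0_cp ?ltW.
have -> : intg (- L) L (phit^~ t) = intg (- L) L psi.
  have := intg_deriv LL cflux (fun x _ => dflux x).
  have [-> ->] := V_edge t; rewrite !mul0r subrr intgD//; last first.
    by have cp : continuous (phit^~ t) := ctx cphit; continuity.
  rewrite intgN; last exact: ctx.
  by move/eqP; rewrite subr_eq0 => /eqP.
have -> : 4 * B * L * e ^+ 2 = intg (- L) L (fun=> 2 * B * e ^+ 2).
  by rewrite intg_const//; ring.
apply: le_intg => //; first by continuity.
move=> x hx; apply: (le_trans (ler_norm _)).
have E0 : 0 <= e ^+ 2 by rewrite sqr_ge0.
(* The quotient [m / phi] is thus at most 1 in size, which leaves the factor [e ^+ 2]
   uncompensated. *)
have mphi : `|m x t| <= phi x t.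
  by rewrite -sqrtr_sqr; apply: ler_wsqrtr; rewrite lerDl.
rewrite /psi; move: (e ^+ 2) E0 => E E0.
rewrite !normrM normfV (gtr0_norm (phi0 x t)) (ger0_norm E0) (@ger0_norm _ 2)//.
rewrite ler_pdivrMr//.
have -> : 2 * `|ux x t| * `|m x t| * E = (2 * `|ux x t| * E) * `|m x t|.
  by ring.
rewrite ler_pM// ?mulr_ge0//.
by rewrite ler_wpM2r// ler_wpM2l// hB.
Qed.

(** The renormalised mass grows by at most a multiple of [e ^+ 2] and exceeds the mass by at most
    [2 L e] at time 0; both errors vanish with [e]. *)
Lemma mass_le t : 0 <= t <= tau -> mass t <= mass 0.
Proof.
move=> /andP[t0 tt].
have LL : - L <= L by rewrite ge0_cp ?ltW.
have [B B0 hB] := bounded2 (- L) L 0 tau cux.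
pose phi e x t : R := Num.sqrt (m x t ^+ 2 + e ^+ 2).
have cphi e : continuous2 (phi e) by rewrite /continuous2 /phi; apply: continuous_sqrt_of; continuity.
have step e : 0 < e ->
    intg (- L) L (phi e ^~ t) - intg (- L) L (phi e ^~ 0) <= 4 * B * L * e ^+ 2 * t.
  move=> e0.
  have hd s : exists d, 0 < s < t -> is_derive s 1
      (fun t => intg (- L) L (phi e ^~ t)) d /\ d <= 4 * B * L * e ^+ 2.
    have [hs|hs] := pselect (0 < s < t); last by exists 0.
    have hs' : 0 < s < tau by case/andP: hs => -> /lt_le_trans ->.
    have [|d d1 d2] := @deriv_intg_sqrt e s B e0 hs'.
      by move=> x hx; apply: hB => //; rewrite !ltW; case/andP: hs'.
    by exists d.
  have [d hd'] := choice hd.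
  pose M s := 4 * B * L * e ^+ 2 * s.
  have -> : 4 * B * L * e ^+ 2 * t = M t - M 0 by rewrite /M; ring.
  apply: (@le_deriv R (fun s => intg (- L) L (phi e ^~ s)) M d
    (fun=> 4 * B * L * e ^+ 2)).
  - by [].
  - by apply: continuous_intg; exact: cphi.
  - by rewrite /M; continuity.
  - by move=> s /hd'[].
  - by move=> s _; rewrite /M; derivation; ring.
  - by move=> s /hd'[].
apply/ler_addgt0Pr => d d0.
(* For [e <= 1], where [e ^+ 2 <= e], the two errors together are at most [e * K]. *)
pose K := 2 * L + 4 * B * L * t + 1.
have K0 : 0 < K.
  by rewrite /K ltr_wpDl// addr_ge0 ?mulr_ge0// ltW.
pose e := Num.min 1 (d / K).
have e0 : 0 < e by rewrite lt_min ltr01 divr_gt0.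
have e1 : e <= 1 by rewrite ge_min lexx.
have eK : e * K <= d by rewrite -ler_pdivlMr// ge_min lexx orbT.
have cn s : continuous (fun x => `|m x s|) by continuity.
have h1 : mass t <= intg (- L) L (phi e ^~ t).
  apply: le_intg => //; first exact: ctx.
  by move=> x _; rewrite -sqrtr_sqr; apply: ler_wsqrtr; rewrite lerDl sqr_ge0.
have h2 : intg (- L) L (phi e ^~ 0) <= mass 0 + 2 * L * e.
  have -> : 2 * L * e = intg (- L) L (fun=> e) by rewrite intg_const//; ring.
  rewrite -intgD//; last by continuity.
  have cn0 := cn 0; apply: le_intg; [exact: ctx|by continuity|move=> x _].
  have me0 : 0 <= `|m x 0| + e by rewrite addr_ge0// ltW.
  rewrite /phi -(ger0_norm me0) -(sqrtr_sqr (`|m x 0| + e)); apply: ler_wsqrtr.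
  rewrite sqrrD real_normK ?num_real// lerD2r lerDl mulrn_wge0// mulr_ge0// ltW//.
have h3 := step e e0.
have h4 : 4 * B * L * e ^+ 2 * t <= e * (4 * B * L * t).
  have -> : 4 * B * L * e ^+ 2 * t = e * (4 * B * L * t) * e by ring.
  by rewrite ler_piMr// !mulr_ge0// ltW.
by move: eK; rewrite /K !mulrDr; nra.
Qed.

(** * Bounds on u, ux and V, and the material derivative of ux *)

Let LL : - L <= L.
Proof. by rewrite ge0_cp ?ltW. Qed.

Let expRK x (a : R) : expR x * (expR (- x) * a) = a.
Proof. by rewrite mulrA -expRD subrr expR0 mul1r. Qed.

Let expRNK x (a : R) : expR (- x) * (expR x * a) = a.
Proof. by rewrite mulrA -expRD addNr expR0 mul1r. Qed.

Lemma norm_exp_intg_right (f : R -> R) x : continuous f ->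
  `|expR x * intg x L (fun y => expR (- y) * f y)| <= intg x L (fun y => `|f y|).
Proof.
move=> cf; have cg : continuous (fun y => expR (- y) * f y) by continuity.
rewrite -intgZ// (le_trans (le_norm_intg _ _ _))//; first by continuity.
apply: le_intg; [by continuity|by continuity|move=> y /andP[xy _]].
rewrite mulrA -expRD normrM ger0_norm ?expR_ge0// ler_piMl//.
by rewrite -expR0 ler_expR subr_le0.
Qed.

Lemma norm_exp_intg_left (f : R -> R) x : continuous f ->
  `|expR (- x) * intg (- L) x (fun y => expR y * f y)| <=
    intg (- L) x (fun y => `|f y|).
Proof.
move=> cf; have cg : continuous (fun y => expR y * f y) by continuity.
rewrite -intgZ// (le_trans (le_norm_intg _ _ _))//; first by continuity.
apply: le_intg; [by continuity|by continuity|move=> y /andP[_ yx]].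
rewrite mulrA -expRD normrM ger0_norm ?expR_ge0// ler_piMl//.
by rewrite -expR0 ler_expR addrC subr_le0.
Qed.

(** One half of the convolution with [G]: the function [expR (- y) * (u + ux)] has derivative
    [- expR (- y) * m] and vanishes at [L]. *)
Lemma u_add_ux x t : - L <= x <= L ->
  u x t + ux x t = expR x * intg x L (fun y => expR (- y) * m y t).
Proof.
move=> /andP[Lx xL]; have cmt' : continuous (m^~ t) := ctx cm.
have cf : continuous (fun y => - (expR (- y) * m y t)) by continuity.
have d y : is_derive y 1 (fun y => expR (- y) * (u y t + ux y t))
    (- (expR (- y) * m y t)).
  by have := du y t; have := dux y t => d2 d1; derivation; ring.
have := intg_deriv xL cf (fun y _ => d y).
rewrite intgN; last by continuity.
rewrite [u L t](strip_right S) ?lexx// addNr mulr0 sub0r => h.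
by rewrite -[LHS](expRK x); congr (_ * _); apply: oppr_inj; rewrite h.
Qed.

Lemma u_sub_ux x t : - L <= x <= L ->
  u x t - ux x t = expR (- x) * intg (- L) x (fun y => expR y * m y t).
Proof.
move=> /andP[Lx xL]; have cmt' : continuous (m^~ t) := ctx cm.
have cf : continuous (fun y => expR y * m y t) by continuity.
have d y : is_derive y 1 (fun y => expR y * (u y t - ux y t)) (expR y * m y t).
  by have := du y t; have := dux y t => d2 d1; derivation; ring.
have := intg_deriv Lx cf (fun y _ => d y).
rewrite [u (- L) t](strip_left S) ?lexx// subrr mulr0 subr0 => h.
by rewrite -[LHS](expRNK x) h.
Qed.

(** The numbers [u + ux] and [u - ux] see only the mass to the right and to the left of [x], so
    their sizes add up to at most the total mass. V is their product, at most a quarter of the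
    squared sum. *)
Lemma strip_bounds x t : - L <= x <= L -> 0 <= t <= tau ->
  [/\ `|u x t| <= mass 0 / 2, `|ux x t| <= mass 0 / 2 &
      `|V x t| <= mass 0 ^+ 2 / 4].
Proof.
move=> hx ht; have cmt' : continuous (m^~ t) := ctx cm.
have ca : continuous (fun x => `|m x t|) by continuity.
have ha : `|u x t + ux x t| <= intg x L (fun y => `|m y t|).
  by rewrite u_add_ux//; exact: norm_exp_intg_right.
have hb : `|u x t - ux x t| <= intg (- L) x (fun y => `|m y t|).
  by rewrite u_sub_ux//; exact: norm_exp_intg_left.
have hm : intg (- L) x (fun y => `|m y t|) + intg x L (fun y => `|m y t|) <= mass 0.
  by rewrite -intg_cat//; [exact: mass_le|case/andP: hx..].
have VE : V x t = (u x t + ux x t) * (u x t - ux x t) by rewrite /V; ring.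
have M0 : 0 <= mass 0 by apply: intg_ge0.
rewrite VE normrM.
move: ha hb hm M0; set I := intg x L _; set J := intg (- L) x _; set M := mass 0.
set a := u x t + ux x t; set b := u x t - ux x t => ha hb hm M0.
have -> : u x t = (a + b) / 2 by rewrite /a /b; field.
have -> : ux x t = (a - b) / 2 by rewrite /a /b; field.
have hab : `|a| + `|b| <= M by lra.
rewrite !normrM (@ger0_norm _ 2^-1)//; split.
- by rewrite ler_wpM2r// (le_trans (ler_normD _ _)).
- by rewrite ler_wpM2r// (le_trans (ler_normB _ _)).
- have a0 : 0 <= `|a| by []; have b0 : 0 <= `|b| by [].
  move: hab a0 b0; move: `|a| `|b| => p q hab a0 b0.
  rewrite ler_pdivlMr//.
  have : (p + q) ^+ 2 <= M ^+ 2 by rewrite ler_sqr ?nnegrE ?addr_ge0.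
  have : 0 <= (p - q) ^+ 2 by rewrite sqr_ge0.
  by rewrite !sqrrB !sqrrD; lra.
Qed.

(** The added term is [V * uxx]. Since [mt = - (V m)_x], integrating the two half-convolutions by
    parts gives [V m - G * (V m)] for the time derivative, and the local term [V m] cancels. What
    remains is [V u], at most (M^2/4)(M/2), and [G * (V m)], at most half of (M^2/4) M. *)
Lemma deriv_ux_time x t : - L <= x <= L -> 0 < t < tau ->
  exists2 d, is_derive t 1 (ux x) d & `|d + V x t * (u x t - m x t)| <= mass 0 ^+ 3 / 4.
Proof.
move=> hx ht; have /andP[Lx xL] := hx.
have ht' : 0 <= t <= tau by rewrite !ltW; case/andP: ht.
pose F y := V y t * m y t.
have cF : continuous F by rewrite /F; have := ctx cVel; have := ctx cm => h1 h2; continuity.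
have cmtt : continuous (mt^~ t) := ctx cmt.
have dF y : is_derive y 1 F (- mt y t).
  rewrite /F; have := dV y t; have := dm y t => d1 d2.
  by apply: (is_derive_eq (is_derive_mul d2 d1)); rewrite /mt; ring.
have mt_left : continuous2 (fun y s => expR y * mt y s).
  by rewrite /continuous2; continuity.
have mt_right : continuous2 (fun y s => expR (- y) * mt y s).
  by rewrite /continuous2; continuity.
have ml : continuous2 (fun y s => expR y * m y s) by rewrite /continuous2; continuity.
have mr : continuous2 (fun y s => expR (- y) * m y s) by rewrite /continuous2; continuity.
have dR := deriv_intg x L mr mt_right.
have dL := deriv_intg (- L) x ml mt_left.
have {}dR : is_derive t 1 (fun s => intg x L (fun y => expR (- y) * m y s))
    (intg x L (fun y => expR (- y) * mt y t)).
  apply: dR ht => y s hs; have := strip_dtm S y hs => d.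
  by apply: (is_derive_eq (is_derive_mul (is_derive_const (expR (- y)) s) d)); rewrite /mt /V; ring.
have {}dL : is_derive t 1 (fun s => intg (- L) x (fun y => expR y * m y s))
    (intg (- L) x (fun y => expR y * mt y t)).
  apply: dL ht => y s hs; have := strip_dtm S y hs => d.
  by apply: (is_derive_eq (is_derive_mul (is_derive_const (expR y) s) d)); rewrite /mt /V; ring.
pose P := intg x L (fun y => expR (- y) * F y).
pose Q := intg (- L) x (fun y => expR y * F y).
have eR : intg x L (fun y => expR (- y) * mt y t) = expR (- x) * F x - P.
  have cf : continuous (fun y => - (expR (- y) * mt y t) + - (expR (- y) * F y)) by continuity.
  have d y : is_derive y 1 (fun y => expR (- y) * F y)
      (- (expR (- y) * mt y t) + - (expR (- y) * F y)).
    by have := dF y => dFy; derivation; ring.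
  have := intg_deriv xL cf (fun y _ => d y).
  rewrite intgD; [|by continuity|by continuity]; rewrite !intgN; [|by continuity|by continuity].
  rewrite -/P; set I := intg _ _ _; have -> : F L = 0 by rewrite /F (V_edge t).2 mul0r.
  by lra.
have eL : intg (- L) x (fun y => expR y * mt y t) = Q - expR x * F x.
  have cf : continuous (fun y => - (expR y * mt y t) + (expR y * F y)) by continuity.
  have d y : is_derive y 1 (fun y => expR y * F y)
      (- (expR y * mt y t) + (expR y * F y)).
    by have := dF y => dFy; derivation; ring.
  have := intg_deriv Lx cf (fun y _ => d y).
  rewrite intgD; [|by continuity|by continuity]; rewrite intgN; last by continuity.
  rewrite -/Q; set I := intg _ _ _; have -> : F (- L) = 0 by rewrite /F (V_edge t).1 mul0r.
  by lra.
have uxE : ux x = (fun s => (expR x * intg x L (fun y => expR (- y) * m y s) -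
    expR (- x) * intg (- L) x (fun y => expR y * m y s)) / 2).
  by apply/funext => s; rewrite -u_add_ux// -u_sub_ux//; field.
exists (F x - (expR x * P + expR (- x) * Q) / 2).
  rewrite uxE.
  apply: (is_derive_eq (is_derive_mul (is_derive_sub
    (is_derive_mul (is_derive_const _ _) dR)
    (is_derive_mul (is_derive_const _ _) dL)) (is_derive_const _ _))).
  by rewrite eR eL !mulrBr expRK expRNK; field.
have hPQ : `|expR x * P + expR (- x) * Q| <= mass 0 ^+ 3 / 4.
  rewrite (le_trans (ler_normD _ _))//.
  have h1 := norm_exp_intg_right x cF; have h2 := norm_exp_intg_left x cF.
  have cnF : continuous (fun y => `|F y|) by continuity.
  rewrite (le_trans (lerD h1 h2))// addrC -intg_cat//.
  have cmt' : continuous (m^~ t) := ctx cm.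
  have ca : continuous (fun x => `|m x t|) by continuity.
  have : intg (- L) L (fun y => `|F y|) <=
      intg (- L) L (fun y => mass 0 ^+ 2 / 4 * `|m y t|).
    apply: le_intg => //; first by continuity.
    move=> y hy; rewrite /F normrM ler_wpM2r//.
    by have [_ _] := strip_bounds hy ht'.
  move/le_trans; apply; rewrite intgZ//.
  have -> : mass 0 ^+ 3 / 4 = mass 0 ^+ 2 / 4 * mass 0 by field.
  by rewrite ler_wpM2l ?divr_ge0 ?sqr_ge0//; exact: mass_le.
have -> : F x - (expR x * P + expR (- x) * Q) / 2 + V x t * (u x t - m x t) =
  V x t * u x t - (expR x * P + expR (- x) * Q) / 2 by rewrite /F; field.
have [hu _ hV] := strip_bounds hx ht'.
have hVu : `|V x t * u x t| <= mass 0 ^+ 2 / 4 * (mass 0 / 2).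
  by rewrite normrM ler_pM.
rewrite (le_trans (ler_normB _ _))// (normrM _ 2^-1) (@ger0_norm _ 2^-1)//.
have -> : mass 0 ^+ 3 / 4 = mass 0 ^+ 2 / 4 * (mass 0 / 2) + (mass 0 ^+ 3 / 4) / 2.
  by field.
by rewrite lerD// ler_wpM2r.
Qed.

(* At the first time at which m^2 (1/A - M t)^2 reaches 1 its maximum point has
   m_x = 0, so m_t = - 2 ux m^2 is smaller in size than M m^2. *)
Lemma strip_m_bound (A M : R) : 0 < A -> (forall x, - L <= x <= L -> `|m x 0| < A) ->
  mass 0 < M -> tau * (A * M) < 1 ->
  forall x t, 0 <= t < tau -> `|m x t| <= (A^-1 - M * t)^-1.
Proof.
move=> A0 mA mM tauAM x t /andP[t0 ttau].
have mass0 : 0 <= mass 0 by apply: intg_ge0.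
have M0 : 0 < M := le_lt_trans mass0 mM.
pose r s := A^-1 - M * s.
have r0 s : s <= t -> 0 < r s.
  move=> st; rewrite /r subr_gt0 -[ltRHS]mul1r ltr_pdivlMr//.
  apply: le_lt_trans tauAM.
  have -> : M * s * A = s * (A * M) by ring.
  by rewrite ler_wpM2r ?mulr_ge0 ?ltW// (le_lt_trans st).
have rt0 := r0 t (lexx _).
have [xL|xL] := leP L `|x|.
  by rewrite (strip_supp S)// normr0 invr_ge0 ltW.
have {xL} hx : - L <= x <= L by rewrite -ler_norml ltW.
pose f y s := (m y s * r s) ^+ 2.
have cf : continuous2 f by rewrite /continuous2 /f /r; continuity.
have f0 y : - L <= y <= L -> f y 0 < 1.
  move=> /mA myA; rewrite /f /r mulr0 subr0 -(real_normK (num_real _)) -[ltRHS](expr1n _ 2).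
  rewrite ltr_pXn2r ?nnegrE// normrM [`|A^-1|]gtr0_norm ?invr_gt0//.
  by rewrite ltr_pdivrMr// mul1r.
have [H|[y [s [hy hs fys fy1 fs1]]]] := first_touch t cf f0.
  have := H x t hx; rewrite t0 lexx => /(_ isT).
  rewrite /f -(real_normK (num_real _)) -[ltRHS](expr1n _ 2) ltr_pXn2r ?nnegrE//.
  rewrite normrM (gtr0_norm rt0) => /ltW h.
  by rewrite -[leRHS]mul1r ler_pdivlMr.
exfalso.
have st : s <= t by case/andP: hs.
have s0 : 0 < s by case/andP: hs.
have stau : 0 < s < tau by rewrite s0 (le_lt_trans st).
have rs0 := r0 s st.
have yL : `|y| < L.
  rewrite ltNge; apply/negP => Ly; move: fys.
  rewrite /f (strip_supp S)// mul0r expr0n/= => /eqP.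
  by rewrite eq_sym oner_eq0.
set g := m y s * r s.
have g2 : g ^+ 2 = 1 := fys.
have g0 : g != 0.
  by apply: contra_eq_neq g2 => ->; rewrite expr0n/= eq_sym oner_neq0.
have my0 : m y s != 0 by apply: contra_neq g0; rewrite /g => ->; rewrite mul0r.
have mx0 : mx y s = 0.
  have dmy := dm y s.
  have dfy : is_derive y 1 (f^~ s) (2 * g * (mx y s * r s)).
    by apply: (is_derive_eq (is_derive_sqr
      (is_derive_mul dmy (is_derive_const (r s) y)))); rewrite /g; ring.
  have : 2 * g * (mx y s * r s) = 0.
    apply: (deriv_local_max dfy (dl := L - `|y|)); first by rewrite subr_gt0.
    move=> z hz; rewrite fys; apply: fy1; rewrite -ler_norml.
    by have := ler_normD (z - y) y; rewrite subrK; lra.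
  have g20 : 2 * g != 0 by apply: mulf_neq0 => //; rewrite pnatr_eq0.
  by move/eqP; rewrite mulf_eq0 (negbTE g20)/= mulf_eq0 (gt_eqF rs0) orbF => /eqP.
have dmt := strip_dtm S y stau.
have dr : is_derive s 1 r (- M) by rewrite /r; derivation; ring.
have dfs : is_derive s 1 (f y) (2 * g * (- 2 * ux y s * m y s ^+ 2 * r s - M * m y s)).
  by apply: (is_derive_eq (is_derive_sqr (is_derive_mul dmt dr))); rewrite mx0 /g; ring.
have : 0 <= 2 * g * (- 2 * ux y s * m y s ^+ 2 * r s - M * m y s).
  apply: (deriv_ge0_left dfs s0) => z hz; rewrite fys ltW// fs1//; lra.
rewrite leNgt => /negP; apply.
(* Times [r s], the derivative becomes [2 * (- 2 ux g - M)] because [g ^+ 2 = 1]; it is negative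
   since [2 |ux| <= mass 0 < M]. *)
rewrite -(pmulr_llt0 _ rs0).
have -> : 2 * g * (- 2 * ux y s * m y s ^+ 2 * r s - M * m y s) * r s =
    2 * (- 2 * (ux y s * g) * g ^+ 2 - M * g ^+ 2) by rewrite /g; ring.
rewrite g2 !mulr1.
have g1 : `|g| = 1 by apply/eqP; rewrite -sqrp_eq1// real_normK ?num_real ?g2.
have stau' : 0 <= s <= tau by case/andP: stau => ? ?; rewrite !ltW.
have [_ hux _] := strip_bounds hy stau'.
have : `|ux y s * g| <= mass 0 / 2 by rewrite normrM g1 mulr1.
rewrite ler_norml; lra.
Qed.

(* Along characteristics 1/m - k, with
     k = - 2 ux (T1 - t) - (M^3/4) (T1 - t)^2,
   is nonincreasing, where M^3/4 bounds the material derivative of ux; and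
   k = 0 at T1.  Instead of following a characteristic we follow a maximum
   point of max(m, 0) k backwards in time from T1. *)
Lemma strip_lifespan xi (p : R) : - L <= xi <= L -> 0 < m xi 0 -> 0 < p ->
  ux xi 0 = - p -> mass 0 ^+ 3 / 2 < m xi 0 * p ^+ 2 ->
  tau <= 2 * p / mass 0 ^+ 3.
Proof.
move=> hxi mxi p0 uxi big; rewrite leNgt; apply/negP.
set M := mass 0 in big *; set T1 := 2 * p / M ^+ 3 => T1tau.
have tau0 : 0 <= tau.
  have Mge0 : 0 <= M by apply: intg_ge0.
  by rewrite (le_trans _ (ltW T1tau))// divr_ge0 ?exprn_ge0// mulr_ge0// ltW.
have M0 : 0 < M.
  have tau00 : 0 <= (0 : R) <= tau by apply/andP.
  have [_ + _] := strip_bounds hxi tau00.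
  by rewrite uxi normrN gtr0_norm// -/M; lra.
have M30 : 0 < M ^+ 3 by rewrite exprn_gt0.
have T10 : 0 < T1 by rewrite divr_gt0// mulr_gt0.
pose c := M ^+ 3 / 4.
pose k x t := - 2 * ux x t * (T1 - t) - c * (T1 - t) ^+ 2.
have ck : continuous2 k by rewrite /continuous2 /k; continuity.
have cprod : continuous2 (fun x t => ux x t * m x t) by rewrite /continuous2; continuity.
have [B B0 hB] := bounded2 (- L) L 0 tau cprod.
pose La := 2 * B + 1.
(* A weight between 1 and 5/4 for nonnegative times; its rate [La] exceeds [2 |ux m|] on the strip,
   which makes the final inequality strict. *)
pose w t := 1 + 4^-1 * expR (- (La * t)).
have w0 t : 0 < w t by rewrite addr_gt0// mulr_gt0// ?expR_gt0.
have cw : continuous w by rewrite /w; continuity.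
(* A positive time is needed because the equation holds only inside the strip; 5/4 is the upper
   bound of the weight. *)
have [t1 t10 ht1] : exists2 t1, 0 < t1 < T1 & 5 / 4 <= m xi t1 * k xi t1 /\ 0 < m xi t1.
  have cf1 : continuous (fun t => m xi t * k xi t - 5 / 4) by continuity.
  have cf2 : continuous (m xi) by continuity.
  have [||d1 d10 h1] := @pos_near R (fun t => m xi t * k xi t - 5 / 4) 0.
  - by [].
  (* Namely [2 p T1 - c T1^2], that is, (4 - 1) p^2 / M^3; the hypothesis then puts [m k] above 3/2
     at [xi]. *)
  - have kE : k xi 0 = 3 * p ^+ 2 / M ^+ 3.
      by rewrite /k uxi /T1 /c; field; rewrite gt_eqF.
    have : 3 / 2 < m xi 0 * k xi 0.
      have -> : m xi 0 * k xi 0 = 3 * (m xi 0 * p ^+ 2) / M ^+ 3 by rewrite kE; ring.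
      by rewrite ltr_pdivlMr//; lra.
    by lra.
  have [d2 d20 h2] := pos_near cf2 mxi.
  pose t1 := Num.min (Num.min d1 d2) T1 / 2.
  have t10 : 0 < t1 by rewrite divr_gt0// !lt_min d10 d20.
  have hmin : [/\ t1 < d1, t1 < d2 & t1 < T1].
    have : 2 * t1 = Num.min (Num.min d1 d2) T1 by rewrite /t1; field.
    have : Num.min (Num.min d1 d2) T1 <= T1 by rewrite ge_min lexx orbT.
    have : Num.min (Num.min d1 d2) T1 <= d1 by rewrite !ge_min lexx.
    have : Num.min (Num.min d1 d2) T1 <= d2 by rewrite !ge_min lexx orbT.
    by move=> e1 e2 e3 e4; split; lra.
  case: hmin => hd1 hd2 hT1.
  exists t1; first by rewrite t10.
  have := h1 t1; have := h2 t1; rewrite !subr0 gtr0_norm// => /(_ hd2) ? /(_ hd1) ?.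
  by split => //; lra.
case: ht1 => ht1 mt1.
(* Here [s] is time counted backwards from [T1], where [k] vanishes. The truncation discards points
   at which [m] and [k] are both negative. *)
pose F x s := Num.max (m x (T1 - s)) 0 * k x (T1 - s) / w (T1 - s).
have cF : continuous2 F.
  have cs : continuous (fun z : R * R => T1 - z.2) by continuity.
  rewrite /continuous2 /F; apply: continuous_mul.
    apply: continuous_mul; last exact: (continuous2_comp ck (@continuous_proj1 R) cs).
    by apply: continuous_max_of;
      [exact: (continuous2_comp cm (@continuous_proj1 R) cs)|exact: continuous_const].
  by apply: continuous_inv_of => [z|]; [rewrite gt_eqF|exact: (continuous_compose cw cs)].
have F0 x : - L <= x <= L -> F x 0 < 1.
  by move=> _; rewrite /F /k subr0 subrr mulr0 expr0n/= mulr0 subr0 mulr0 mul0r.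
have [H|[x [s [hx hs Fxs Fle1 Flt1]]]] := first_touch (T1 - t1) cF F0.
  have := H xi (T1 - t1) hxi; rewrite lexx subr_ge0 ltW; last by case/andP: t10.
  move=> /(_ isT); rewrite /F subKr max_l ?ltW// ltr_pdivrMr// mul1r ltNge.
  apply/negP; rewrite negbK (le_trans _ ht1)// /w.
  have : expR (- (La * t1)) <= 1.
    rewrite -expR0 ler_expR oppr_le0 mulr_ge0 ?ltW//; last by case/andP: t10.
    by rewrite /La addr_gt0// mulr_gt0.
  by lra.
move: hs t10 => /andP[s0 sT] /andP[t10 t1T].
set t := T1 - s in Fxs *.
have ts : T1 - t = s by rewrite /t subKr.
have ht : 0 < t < tau by apply/andP; rewrite /t; split; lra.
have ht' : 0 <= t <= tau by rewrite !ltW; case/andP: ht.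
have mpos : 0 < m x t.
  rewrite ltNge; apply/negP => mneg; move: Fxs.
  rewrite /F -/t max_r// !mul0r => /eqP; rewrite eq_sym oner_eq0.
  by [].
have mk : m x t * k x t = w t.
  by rewrite -[RHS]mul1r -Fxs /F -/t max_l ?ltW// divfK// gt_eqF.
have xL : `|x| < L.
  by rewrite ltNge; apply/negP => Lx; move: mpos; rewrite (strip_supp S)// ltxx.
(* The weight does not depend on [x] and the truncation is inactive near a point with [m > 0], so
   [m k] itself has a local maximum in [x]. *)
have spatial : mx x t * k x t = 2 * m x t * (u x t - m x t) * s.
  have dmx := dm x t; have duxx := dux x t.
  have dkx : is_derive x 1 (k^~ t) (- 2 * (u x t - m x t) * s).
    by rewrite /k ts; derivation; ring.
  have cmt' : continuous (m^~ t) := ctx cm.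
  have [dl dl0 hdl] := pos_near cmt' mpos.
  have := deriv_local_max (is_derive_mul dmx dkx) (dl := Num.min dl (L - `|x|)).
  rewrite lt_min dl0 subr_gt0 xL => /(_ isT) h.
  suff : m x t * (-2 * (u x t - m x t) * s) + mx x t * k x t = 0 by lra.
  apply: h => y; rewrite lt_min => /andP[hy1 hy2].
  have yL : - L <= y <= L.
    by rewrite -ler_norml; have := ler_normD (y - x) x; rewrite subrK; lra.
  have my : 0 < m y t := hdl y hy1.
  by rewrite mk; have := Fle1 y yL; rewrite /F -/t (max_l (ltW my)) ler_pdivrMr// mul1r.
have [d dd hd] := deriv_ux_time hx ht.
have dmt := strip_dtm S x ht.
have dkt : is_derive t 1 (k x) (- 2 * d * s + 2 * ux x t + 2 * c * s).
  by rewrite /k; derivation; rewrite ts; ring.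
have dwt : is_derive t 1 w (- (La / 4 * expR (- (La * t)))).
  by rewrite /w; derivation; field.
have cmx' : continuous (m x) by continuity.
have [dl dl0 hdl] := pos_near cmx' mpos.
(* Times just after [t] precede [s] in reversed time, where [F < 1]; hence [m k - w], zero at [t],
   is not positive just after it. *)
have := deriv_le0_right (is_derive_sub (is_derive_mul dmt dkt) dwt) (dl := Num.min dl s).
rewrite lt_min dl0 s0 => /(_ isT) h.
have : m x t * (- 2 * d * s + 2 * ux x t + 2 * c * s) +
   (- ((u x t ^+ 2 - ux x t ^+ 2) * mx x t) - 2 * ux x t * m x t ^+ 2) * k x t -
   - (La / 4 * expR (- (La * t))) <= 0.
  apply: h => z /andP[tz zt].
  have [zdl zs] : z < t + dl /\ z < t + s.
    by move: zt; rewrite -ltrBlDl lt_min => /andP[]; lra.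
  have sz : 0 <= T1 - z < s by apply/andP; rewrite /t in tz zs; split; lra.
  have mz : 0 < m x z by apply: hdl; rewrite gtr0_norm ?subr_gt0//; lra.
  have := Flt1 x (T1 - z) hx sz; rewrite /F subKr (max_l (ltW mz)).
  by rewrite ltr_pdivrMr// mul1r mk subrr subr_le0 => /ltW.
rewrite leNgt => /negP; apply.
set E := expR (- (La * t)) in dwt *.
have E0 : 0 < E by rewrite expR_gt0.
have wE : w t = 1 + E / 4 by rewrite /w -/E mulrC.
set D := d + V x t * (u x t - m x t) in hd.
(* The groups are: the error in the material derivative of [ux], with [c - D >= 0]; V times a factor
   that is zero by [spatial]; and a term with [m k - 1 = E / 4], which the decay of the weight
   outweighs. *)
have -> : m x t * (- 2 * d * s + 2 * ux x t + 2 * c * s) +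
   (- ((u x t ^+ 2 - ux x t ^+ 2) * mx x t) - 2 * ux x t * m x t ^+ 2) * k x t -
   - (La / 4 * E) =
   2 * (m x t * s) * (c - D) - V x t * (mx x t * k x t - 2 * m x t * (u x t - m x t) * s) -
   2 * (ux x t * m x t) * (m x t * k x t - 1) + La / 4 * E.
  by rewrite /D /V; ring.
rewrite spatial subrr mulr0 subr0 mk wE [1 + _ - 1]addrC addKr.
have h1 : 0 <= 2 * (m x t * s) * (c - D).
  have Dc : 0 <= c - D by rewrite subr_ge0 (le_trans (ler_norm _)).
  by rewrite mulr_ge0// !mulr_ge0// ltW.
have h2 : 0 < (La - 2 * (ux x t * m x t)) * (E / 4).
  rewrite mulr_gt0 ?divr_gt0// /La.
  by have := hB x t hx ht'; rewrite ler_norml; lra.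
lra.
Qed.

End Strip.

(** * From classical solutions to strips *)

Section Convolution.
Variable R : realType.
Implicit Types (v U : R -> R) (x y r d : R).

Lemma convG_scale v x r e : convG_defined v r ->
  (forall y, G (x - y) * v y = e * (G (r - y) * v y)) ->
  convG v x = e * convG v r.
Proof.
move=> vr xr; rewrite /convG -RintegralZl//.
by apply: eq_Rintegral => y _; rewrite xr.
Qed.

(** To the left of [r], [U] is an exact multiple of the exponential. The difference vanishes on that
    side only, and since its derivative at [r] is known to exist, the two one-sided sign tests force
    it to be 0. *)
Lemma convG_left v U r d : (forall x, convG_defined v x /\ U x = convG v x) ->
  (forall y, y <= r -> v y = 0) -> is_derive r 1 U d -> d = U r.
Proof.
move=> hU v0 dU.
have UE x : x <= r -> U x = expR (x - r) * U r.
  move=> xr; rewrite (hU x).2 (hU r).2; apply: convG_scale => [|y].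
    exact: (hU r).1.
  have [yr|ry] := leP y r; first by rewrite v0// !mulr0.
  rewrite /G !ler0_norm ?subr_le0 ?ltW//; last exact: le_lt_trans ry.
  rewrite !mulrA [_ * 2^-1]mulrC -[_ * _ * expR _]mulrA -expRD.
  by congr (_ * expR _ * _); ring.
have dgap : is_derive r 1 (fun x => U x - expR (x - r) * U r) (d - U r).
  by derivation; rewrite subrr expR0; ring.
have D0 x : x <= r -> U x - expR (x - r) * U r = 0 by move=> /UE ->; rewrite subrr.
have h1 : 0 <= d - U r.
  by apply: (deriv_ge0_left dgap ltr01) => s /andP[_ sr]; rewrite !D0// ltW.
have h2 : 0 <= - (d - U r).
  by apply: (deriv_ge0_left (is_derive_opp dgap) ltr01) => s /andP[_ sr]; rewrite !D0// ltW.
lra.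
Qed.

Lemma convG_right v U r d : (forall x, convG_defined v x /\ U x = convG v x) ->
  (forall y, r <= y -> v y = 0) -> is_derive r 1 U d -> d = - U r.
Proof.
move=> hU v0 dU.
have UE x : r <= x -> U x = expR (r - x) * U r.
  move=> rx; rewrite (hU x).2 (hU r).2; apply: convG_scale => [|y].
    exact: (hU r).1.
  have [yr|ry] := leP r y; first by rewrite v0// !mulr0.
  rewrite /G !ger0_norm ?subr_ge0 ?ltW//; last exact: lt_le_trans rx.
  rewrite !mulrA [_ * 2^-1]mulrC -[_ * _ * expR _]mulrA -expRD.
  by congr (_ * expR _ * _); ring.
have dgap : is_derive r 1 (fun x => U x - expR (r - x) * U r) (d + U r).
  by derivation; rewrite subrr expR0; ring.
have D0 x : r <= x -> U x - expR (r - x) * U r = 0 by move=> /UE ->; rewrite subrr.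
have h1 : d + U r <= 0.
  by apply: (deriv_le0_right dgap ltr01) => s /andP[sr _]; rewrite !D0// ltW.
have h2 : - (d + U r) <= 0.
  by apply: (deriv_le0_right (is_derive_opp dgap) ltr01) => s /andP[sr _]; rewrite !D0// ltW.
lra.
Qed.

End Convolution.

(** * Freezing time outside a compact interval *)

Section SolutionStrip.
Variables (R : realType) (tau : R).
Hypothesis tau0 : 0 < tau.
Implicit Types x t : R.

Definition clamp t := Num.max 0 (Num.min t tau).

Lemma clamp_bounds t : 0 <= clamp t <= tau.
Proof.
rewrite /clamp le_max lexx/= ge_max ge_min lexx orbT andbT.
exact: ltW.
Qed.

Lemma clamp_id t : 0 <= t <= tau -> clamp t = t.
Proof. by move=> /andP[t0 tt]; rewrite /clamp min_l// max_r. Qed.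

Lemma clamp_le0 t : t <= 0 -> clamp t = 0.
Proof. by move=> t0; rewrite /clamp max_l// ge_min t0. Qed.

Lemma clamp_gt0 t : 0 < t -> 0 < clamp t.
Proof. by move=> t0; rewrite /clamp lt_max lt_min t0 tau0 orbT. Qed.

Lemma clamp_continuous : continuous clamp.
Proof. by rewrite /clamp; continuity. Qed.

(** [clamp] is a continuous retraction of the time axis into [J], so subspace continuity becomes
    continuity on the plane. *)
Lemma continuous2_clamp (J : set R) (f : R -> R -> R) :
  (forall t, J (clamp t)) ->
  {within [set: R] `*` J, continuous (fun z : R * R => f z.1 z.2)} ->
  continuous2 (fun x t => f x (clamp t)).
Proof.
move=> hJ /subspace_continuousP cf z.
have cz : continuous (fun z : R * R => (z.1, clamp z.2)).
  apply: continuous_pairing; first exact: continuous_proj1.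
  exact: (continuous_compose clamp_continuous (@continuous_proj2 R)).
have h := cf (z.1, clamp z.2) (conj I (hJ _)).
move=> A /h hA; move: (cz z _ hA); rewrite !nbhs_simpl/= => H.
by apply: filterS H => w /=; apply; split.
Qed.

(** Finite propagation enters here and supplies the support and edge conditions. The last conjunct
    ties [ux] at time 0 to the datum. *)
Lemma strip_of_solution (L : R) (k : nat) (m0 : R -> R) (T : \bar R)
    (u m : R -> R -> R) : (1 <= k)%N ->
  tsupport m0 `<=` [set x | - L < x < L] ->
  mCH_classical_solution k m0 T u m -> (tau%:E < T)%E ->
  exists mx ux, strip tau L (fun x t => m x (clamp t)) mx
     (fun x t => u x (clamp t)) ux /\
     (forall x, ux x 0 = derive1 (u ^~ 0) x).
Proof.
move=> k1 supp [cnu cnm hconv hpde hinit] tauT.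
have hI t : time_interval T (clamp t).
  have /andP[h1 h2] := clamp_bounds t; split => //.
  by apply: le_lt_trans tauT; rewrite lee_fin.
case: cnu => du cdu dtu cdtu; case: cnm => dm cdm dtm cdtm.
pose mc (x t : R) : R := m x (clamp t).
pose uc (x t : R) : R := u x (clamp t).
pose mx (x t : R) : R := derive1 (m^~ (clamp t)) x.
pose ux (x t : R) : R := derive1 (u^~ (clamp t)) x.
pose uxx (x t : R) : R := derive1n 2 (u^~ (clamp t)) x.
have cm : continuous2 mc := continuous2_clamp hI (cdm 0%N (leq0n _)).
have cmx : continuous2 mx :=
  continuous2_clamp (f := fun x t => derive1 (m^~ t) x) hI (cdm 1%N k1).
have cu : continuous2 uc := continuous2_clamp hI (cdu 0%N (leq0n _)).
have cux : continuous2 ux :=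
  continuous2_clamp (f := fun x t => derive1 (u^~ t) x) hI (cdu 1%N isT).
have cuxx : continuous2 uxx :=
  continuous2_clamp (f := fun x t => derive1n 2 (u^~ t) x) hI (cdu 2%N isT).
have dmc x t : is_derive x 1 (mc^~ t) (mx x t).
  by split; [exact: (dm 0%N x (clamp t) k1 (hI t))|rewrite -derive1E].
have duc x t : is_derive x 1 (uc^~ t) (ux x t).
  by split; [exact: (du 0%N x (clamp t) isT (hI t))|rewrite -derive1E].
have duxx x t : is_derive x 1 (ux^~ t) (uxx x t).
  by split; [exact: (du 1%N x (clamp t) isT (hI t))|rewrite -derive1E].
(* The relation is given only for positive times; at time 0 it follows by continuity, the reflection
   [s -> - s] making this a limit from the left. *)
have uxxE x t : uxx x t = uc x t - mc x t.
  pose g (s : R) : R := uc x s - mc x s - uxx x s.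
  have cg : continuous g by rewrite /g; continuity.
  have gpos s : 0 < s -> g s = 0.
    move=> s0; have [e _] := hpde x (clamp s) (hI s) (clamp_gt0 s0).
    by rewrite /g /mc e /uc /uxx; ring.
  suff : g t = 0 by rewrite /g; lra.
  have [/gpos//|t0] := ltP 0 t.
  have -> : g t = g 0 by rewrite /g /uc /mc /uxx !clamp_le0.
  have cgN : continuous (fun s : R => g (- s)) :=
    continuous_compose cg (@continuous_opp R R id (@continuous_var R)).
  have cNgN : continuous (fun s => - g (- s)) := continuous_opp cgN.
  have m10 : -1 < 0 :> R by rewrite ltrN10.
  have g1 : g (- 0) <= 0.
    by apply: (le_left_limit cgN m10) => s /andP[_ s0]; rewrite gpos ?oppr_gt0.
  have g2 : - g (- 0) <= 0.
    by apply: (le_left_limit cNgN m10) => s /andP[_ s0]; rewrite gpos ?oppr0 ?oppr_gt0.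
  by move: g1 g2; rewrite oppr0; lra.
have dux x t : is_derive x 1 (ux^~ t) (uc x t - mc x t) by rewrite -uxxE.
have dV x t : is_derive x 1 (fun x => uc x t ^+ 2 - ux x t ^+ 2)
    (2 * ux x t * mc x t).
  have d1 := duc x t; have d2 := dux x t.
  by apply: (is_derive_eq (is_derive_sub (is_derive_sqr d1) (is_derive_sqr d2))); ring.
have dtmc x t : 0 < t < tau -> is_derive t 1 (mc x)
    (- ((uc x t ^+ 2 - ux x t ^+ 2) * mx x t) - 2 * ux x t * mc x t ^+ 2).
  move=> /andP[t0 tt].
  have ct : clamp t = t by rewrite clamp_id// (ltW t0) ltW.
  have It : time_interval T t by rewrite -ct; exact: hI.
  have [_ hp] := hpde x t It t0.
  have dVx := dV x t; have dmx := dmc x t.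
  have dflux := is_derive_mul dVx dmx.
  have dfl : derive1 (fun y => (u y t ^+ 2 - derive1 (u^~ t) y ^+ 2) * m y t) x =
      (uc x t ^+ 2 - ux x t ^+ 2) * mx x t + 2 * ux x t * mc x t * mc x t.
    by rewrite derive1E; move: dflux; rewrite /uc /ux /mc /mx ct => -[].
  (* Since [t] is interior, every small increment is admissible and the relative difference quotient
     has the ordinary limit. *)
  have der1 : derivable (m x) t 1.
    have := dtm 0%N x t isT It; rewrite /derivable_in /= => h.
    rewrite /derivable.
    have E : (fun h => h^-1 *: ((m x \o shift t) (h *: 1) - m x t)) = diff_quot (m x) t.
      by apply/funext => s; rewrite /= /diff_quot [s%:A]mulr1.
    have near0 : \forall h \near 0^', time_interval T (h + t).
      have e0 : 0 < Num.min t (tau - t) by rewrite lt_min t0 subr_gt0.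
      exists (Num.min t (tau - t)) => //= s; rewrite /ball_/= sub0r normrN lt_min => /andP[s1 s2] _.
      have st : 0 <= s + t <= tau.
        by move: s1 s2; rewrite !ltr_norml => /andP[? _] /andP[_ ?]; lra.
      by rewrite -(clamp_id st); exact: hI.
    move: h => /cvg_ex[l hl]; apply/cvg_ex; exists l; rewrite E => A /hl.
    rewrite !nbhs_simpl/= => H.
    by apply: filterS2 near0 H => s h1; apply.
  apply: (@near_eq_is_derive _ _ _ (m x)).
    near=> s; rewrite /mc clamp_id//; apply/andP; split; apply/ltW.
      by near: s; exact: lt_nbhsr.
    by near: s; exact: lt_nbhsl.
  split; first exact: der1.
  rewrite -derive1E; move: hp; rewrite dfl.
  by lra.
have csupp x : L <= `|x| -> m0 x = 0.
  move=> Lx; apply: contrapT => /eqP mx0.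
  have : tsupport m0 x by apply: subset_closure.
  by move/supp => /=; move: Lx; rewrite ler_normr => /orP[]; lra.
have mc0 x : L <= `|x| -> mc x 0 = 0.
  by move=> /csupp; rewrite /mc clamp_le0// hinit; apply.
have hU t x : convG_defined (mc^~ t) x /\ uc x t = convG (mc^~ t) x.
  exact: hconv.
have left0 r t : (forall y, y <= r -> mc y t = 0) -> ux r t = uc r t.
  by move=> h; apply: (convG_left (hU t) h); exact: duc.
have right0 r t : (forall y, r <= y -> mc y t = 0) -> ux r t = - uc r t.
  by move=> h; apply: (convG_right (hU t) h); exact: duc.
(* The equation in the form [m_t = W m_x + g m] with [W = - V], and the relation [W_x = h m] that
   finite propagation rests on. *)
pose W (x t : R) : R := - (uc x t ^+ 2 - ux x t ^+ 2).
pose g (x t : R) : R := - (2 * ux x t * mc x t).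
pose h (x t : R) : R := - (2 * ux x t).
have cW : continuous2 W by rewrite /continuous2 /W; continuity.
have cg : continuous2 g by rewrite /continuous2 /g; continuity.
have ch : continuous2 h by rewrite /continuous2 /h; continuity.
have dW (x t : R) : is_derive x 1 (W^~ t) (h x t * mc x t).
  by apply: (is_derive_eq (is_derive_opp (dV x t))); rewrite /h; ring.
have dtW (x t : R) : 0 < t < tau ->
    is_derive t 1 (mc x) (W x t * mx x t + g x t * mc x t).
  by move=> /(dtmc x) d; apply: (is_derive_eq d); rewrite /W /g; ring.
have supp_pos t : 0 <= t <= tau -> forall x, L <= `|x| -> mc x t = 0.
  move=> ht x; rewrite ler_normr => /orP[Lx|xL].
  - apply: (@vanish_right R mc mx W g h L tau) => // [r s _ H|y Ly].
      by rewrite /W right0// sqrrN subrr oppr0.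
    by apply: mc0; rewrite ler_normr Ly.
  - apply: (@vanish_left R mc mx W g h (- L) tau) => // [r s _ H|y yL|].
    + by rewrite /W left0// subrr oppr0.
    + by apply: mc0; rewrite ler_normr lerNr yL orbT.
    + by rewrite lerNr.
have clamp_clamp t : clamp (clamp t) = clamp t by apply: clamp_id; exact: clamp_bounds.
have suppm x t : L <= `|x| -> mc x t = 0.
  move=> Lx; have := supp_pos _ (clamp_bounds t) x Lx.
  by rewrite /mc clamp_clamp.
exists mx, ux; split; last by move=> x; rewrite /ux clamp_le0.
split => //.
- move=> x t xL; symmetry; apply: left0 => y yx; apply: suppm.
  by rewrite ler_normr lerNr (le_trans yx xL) orbT.
- move=> x t Lx; rewrite -[LHS]opprK; congr (- _); symmetry; apply: right0 => y xy.
  by apply: suppm; rewrite ler_normr (le_trans Lx xy).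
Unshelve. all: by end_near. Qed.

End SolutionStrip.

(** * Lifespan *)

Section Norms.
Variable R : realType.
Implicit Types (f : R -> R) (x L K : R).

(** The norm with exponent [+oo] is the essential supremum only when the whole space has positive
    measure, which is checked here. *)
Lemma normLinfE f : normLinf f = ess_sup (LebesgueMeasure R) (abse \o (EFin \o f)).
Proof.
rewrite /normLinf unlock ifT//.
have -> : LebesgueMeasure R setT = lebesgue_measure (`]-oo, +oo[%classic : set R).
  by rewrite set_itvNyy.
by rewrite lebesgue_measure_itv/=; exact: ltry.
Qed.

Lemma normLinf_le f K : (forall x, `|f x| <= K) -> (normLinf f <= K%:E)%E.
Proof.
by move=> fK; rewrite normLinfE; apply/ess_supP/aeW => x /=; rewrite lee_fin.
Qed.

(** By continuity, an excess at one point persists on a ball, which has positive measure. *)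
Lemma normLinf_ge f x : continuous f -> (`|f x|%:E <= normLinf f)%E.
Proof.
move=> cf; rewrite leNgt; apply/negP => lt.
have := ess_sup_ge (LebesgueMeasure R) (abse \o (EFin \o f)).
rewrite -normLinfE => -[A [mA A0 sub]].
have [S hS] : exists S, (normLinf f <= S%:E)%E /\ S < `|f x|.
  have n0 : (0 <= normLinf f)%E := Lnorm_ge0 _ _ _.
  case E : (normLinf f) n0 lt => [s| |]// _ lt.
  by exists s; rewrite lexx.
have cn : continuous (fun x => `|f x| - S) by continuity.
have [|e e0 he] := @pos_near R (fun x => `|f x| - S) x cn.
  by rewrite subr_gt0; case: hS.
have ballA : ball x e `<=` A.
  move=> y; rewrite /ball/= distrC => /he; rewrite subr_gt0 => Sy.
  apply: sub => /=; apply/negP; rewrite -ltNge.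
  by apply: le_lt_trans hS.1 _; rewrite lte_fin.
have : (LebesgueMeasure R (ball x e) <= LebesgueMeasure R A)%E.
  by apply: le_measure => //; rewrite inE//; rewrite ball_itv; exact: measurable_itv.
rewrite A0; have -> : LebesgueMeasure R (ball x e) = (e *+ 2)%:E.
  exact: (lebesgue_measure_ball x (ltW e0)).
by rewrite lee_fin leNgt mulrn_wgt0.
Qed.

Lemma normL1E f L : continuous f -> (forall x, L <= `|x| -> f x = 0) ->
  normL1 f = (intg (- L) L (fun x => `|f x|))%:E.
Proof.
move=> cf f0; rewrite /normL1 Lnorm1.
have ca : continuous (fun x => `|f x|) by continuity.
rewrite /intg /Rintegral fineK; last first.
  by apply: integrable_fin_num => //; exact: integrable_itv.
rewrite [RHS]integral_mkcond; apply: eq_integral => x _.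
rewrite patchE; case: ifPn => // /negP xI.
rewrite /= f0 ?normr0//; have [//|xL] := leP L `|x|.
by exfalso; apply: xI; rewrite inE /= in_itv/= -ler_norml ltW.
Qed.

End Norms.

(** The equation is odd under [(m, u) -> (- m, - u)], its nonlinearity being cubic; this reduces a
    negative value of the datum to a positive one. *)
Lemma stripN (R : realType) (tau L : R) (m mx u ux : R -> R -> R) :
  strip tau L m mx u ux -> strip tau L (fun x t => - m x t) (fun x t => - mx x t)
    (fun x t => - u x t) (fun x t => - ux x t).
Proof.
case=> cm cmx cu cux dm du dux dtm supp left right; split.
- exact: continuous_opp.
- exact: continuous_opp.
- exact: continuous_opp.
- exact: continuous_opp.
- by move=> x t; exact: is_derive_opp.
- by move=> x t; exact: is_derive_opp.
- by move=> x t; have d := dux x t; apply: (is_derive_eq (is_derive_opp d)); ring.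
- by move=> x t ht; have d := dtm x t ht; apply: (is_derive_eq (is_derive_opp d)); ring.
- by move=> x t Lx; rewrite supp// oppr0.
- by move=> x t xL; rewrite left.
- by move=> x t Lx; rewrite right.
Qed.

(** * Lower and upper bounds on the maximal time *)

Section Lifespan.
Variables (R : realType) (L : R) (k : nat).
Hypotheses (L0 : 0 < L) (k1 : (1 <= k)%N).
Implicit Types T : \bar R.

(** If the product were below 1, the Riccati bound would keep [m] bounded up to [Tr], against
    blow-up there. Stated as a product, it also says that a finite maximal time excludes a zero
    product of norms. *)
Lemma lifespan_ge (m0 : R -> R) (a Tr : R) : tsupport m0 `<=` [set x | - L < x < L] ->
  (forall x, `|m0 x| <= a) -> is_Tmax k m0 Tr%:E ->
  1 <= Tr * (a * intg (- L) L (fun x => `|m0 x|)).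
Proof.
move=> supp m0a [+ [u [m [sol fin blow]]]]; rewrite lte_fin => Tr0.
set M := intg _ _ _; rewrite leNgt; apply/negP => lt1.
have M0 : 0 <= M by apply: intg_ge0.
have a0 : 0 <= a by rewrite (le_trans _ (m0a 0)).
(* The Riccati bound requires strict majorants of the sup norm and of the mass; enlarging both by
   [d] costs at most half of the available slack. *)
pose d := Num.min 1 ((1 - Tr * (a * M)) / (2 * (Tr * (a + M + 1) + 1))).
have den : 0 < Tr * (a + M + 1) + 1.
  by rewrite ltr_wpDl// mulr_ge0 ?ltW// ltr_wpDl// addr_ge0.
have d0 : 0 < d by rewrite lt_min ltr01 divr_gt0 ?subr_gt0// mulr_gt0.
have d1 : d <= 1 by rewrite ge_min lexx.
have d2 : d * (2 * (Tr * (a + M + 1) + 1)) <= 1 - Tr * (a * M).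
  by rewrite -ler_pdivlMr ?mulr_gt0// ge_min lexx orbT.
pose A := a + d; pose M' := M + d.
have A0 : 0 < A by rewrite /A ltr_wpDl.
have M'0 : 0 < M' by rewrite /M' ltr_wpDl.
have AM : Tr * (A * M') < 1.
  have -> : Tr * (A * M') = Tr * (a * M) + d * (Tr * (a + M + d)).
    by rewrite /A /M'; ring.
  have h1 : d * (Tr * (a + M + d)) <= d * (Tr * (a + M + 1)).
    by rewrite ler_wpM2l ?(ltW d0)// ler_wpM2l ?(ltW Tr0)// lerD2l.
  have h2 : 0 <= d * (Tr * (a + M + 1)).
    by rewrite !mulr_ge0 ?ltW// ltr_wpDl// addr_ge0.
  by move: d2; rewrite mulrCA mulrDr mulr1; lra.
pose K := (A^-1 - M' * Tr)^-1.
have K0 : 0 < A^-1 - M' * Tr.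
  rewrite subr_gt0 -[ltRHS]mul1r ltr_pdivlMr//.
  by have -> : M' * Tr * A = Tr * (A * M') by ring.
(* Each [t] uses its own strip, ending halfway between [t] and [Tr]; the bound [K] is common to all
   of them. *)
have mK t : 0 <= t < Tr -> forall x, `|m x t| <= K.
  move=> /andP[t0 tT] x.
  pose tau := (t + Tr) / 2.
  have ttau : t < tau by rewrite /tau; lra.
  have tau0 : 0 < tau by lra.
  have tauT : (tau%:E < Tr%:E)%E by rewrite lte_fin /tau; lra.
  have [mx [ux [S _]]] := strip_of_solution tau0 k1 supp sol tauT.
  have init y : m y (clamp tau 0) = m0 y by rewrite clamp_le0//; case: sol.
  have massE : intg (- L) L (fun y => `|m y (clamp tau 0)|) = M.
    by apply: eq_intg => y _; rewrite init.
  have := strip_m_bound L0 S A0 (M := M'); rewrite massE => H.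
  have : `|m x (clamp tau t)| <= (A^-1 - M' * t)^-1.
    apply: H; last by rewrite t0.
    - by move=> y _; rewrite init (le_lt_trans (m0a y))// /A ltrDl.
    - by rewrite /M' ltrDl.
    - by apply: le_lt_trans AM; rewrite ler_wpM2r ?mulr_ge0 ?ltW// /tau; lra.
  have t0tau : 0 <= t <= tau by rewrite t0 ltW.
  rewrite (clamp_id t0tau) => /le_trans; apply.
  rewrite lef_pV2 ?posrE//; first by rewrite lerD2l lerN2 ler_pM2l// ltW.
  by apply: lt_le_trans K0 _; rewrite lerD2l lerN2 ler_pM2l// ltW.
have := blow (ltry _); rewrite /= limf_esupE => blow'.
(* The upper limit is an infimum over left neighbourhoods of [Tr], and [[0, Tr)] is one of them. *)
have : (ereal_inf [set ereal_sup [set normLinf (m^~ x) | x in V] | V in Tr^'-] <= K%:E)%E.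
  apply: ereal_inf_le; exists (ereal_sup [set normLinf (m^~ x) | x in [set t | 0 <= t < Tr]]).
    exists [set t | 0 <= t < Tr] => //.
    near=> t; apply/andP; split => //.
    by apply/ltW; near: t; exact: nbhs_left_gt.
  by apply: ge_ereal_sup => _ [t tT <-]; apply: normLinf_le; exact: mK.
by rewrite blow'.
Unshelve. all: by end_near. Qed.

(** Otherwise some strip would be longer than [1 / M ^+ 2], whereas its length is at most
    [2 |ux| / M ^+ 3] with [|ux| <= M / 2] at [xi]. *)
Lemma lifespan_le (m0 : R -> R) T (xi : R) : tsupport m0 `<=` [set x | - L < x < L] ->
  is_Tmax k m0 T -> - L <= xi <= L ->
  m0 xi * derive1 (convG m0) xi < 0 ->
  intg (- L) L (fun x => `|m0 x|) ^+ 3 / 2 < `|m0 xi| * derive1 (convG m0) xi ^+ 2 ->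
  (T <= ((intg (- L) L (fun x => `|m0 x|) ^+ 2)^-1)%:E)%E.
Proof.
move=> supp [T0 [u [m [sol _ _]]]] hxi neg big; set M := intg _ _ _ in big *.
rewrite leNgt; apply/negP => ltT.
have M0 : 0 <= M by apply: intg_ge0.
have [tau tau1 tauT] : exists2 tau, (M ^+ 2)^-1 < tau & (tau%:E < T)%E.
  case: T ltT {T0 sol} => [r| |]//.
    rewrite lte_fin => h; exists (((M ^+ 2)^-1 + r) / 2); first lra.
    by rewrite lte_fin; lra.
  by move=> _; exists ((M ^+ 2)^-1 + 1); [rewrite ltrDl|rewrite ltry].
have tau0 : 0 < tau by apply: le_lt_trans tau1; rewrite invr_ge0 exprn_ge0.
have [mx [ux [S uxE]]] := strip_of_solution tau0 k1 supp sol tauT.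
have init y : m y (clamp tau 0) = m0 y by rewrite clamp_le0//; case: sol.
have massE : intg (- L) L (fun y => `|m y (clamp tau 0)|) = M.
  by apply: eq_intg => y _; rewrite init.
have massNE : intg (- L) L (fun y => `|- m y (clamp tau 0)|) = M.
  by apply: eq_intg => y _; rewrite normrN init.
have dE : derive1 (convG m0) xi = ux xi 0.
  rewrite uxE; congr (derive1 _ xi); apply/funext => x.
  case: sol => _ _ hconv _ hinit.
  have t00 : time_interval T 0 by [].
  rewrite (hconv x 0 t00).2; congr (convG _ x).
  by apply/funext => y; rewrite hinit.
rewrite dE in neg big; set d := ux xi 0 in neg big.
have d0 : d != 0 by apply: contraTneq neg => ->; rewrite mulr0 ltxx.
have tau00 : 0 <= (0 : R) <= tau by apply/andP; split => //; exact: ltW.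
have [_ d_le _] := strip_bounds L0 S hxi tau00.
rewrite massE -/d in d_le.
have Mpos : 0 < M by have : 0 < `|d|; [rewrite normr_gt0|lra].
have key : tau <= 2 * `|d| / M ^+ 3.
  have [m0pos|m0neg] := ltP 0 (m0 xi).
    have dneg : d < 0 by move: neg; rewrite pmulr_rlt0.
    rewrite (ltr0_norm dneg) -massE; apply: (strip_lifespan L0 S hxi).
    - by rewrite init.
    - by rewrite oppr_gt0.
    - by rewrite opprK.
    - by rewrite massE init sqrrN -[X in _ < X * _](gtr0_norm m0pos).
  have m0lt : m0 xi < 0.
    rewrite lt_neqAle m0neg andbT; apply: contraTneq neg => ->.
    by rewrite mul0r ltxx.
  have dpos : 0 < d by move: neg; rewrite nmulr_rlt0.
  rewrite (gtr0_norm dpos) -massNE; apply: (strip_lifespan L0 (stripN S) hxi).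
  - by rewrite init oppr_gt0.
  - by [].
  - by [].
  - by rewrite massNE init -[X in _ < X * _](ltr0_norm m0lt).
have : 2 * `|d| / M ^+ 3 <= (M ^+ 2)^-1.
  rewrite ler_pdivrMr ?exprn_gt0//.
  have -> : (M ^+ 2)^-1 * M ^+ 3 = M by field; rewrite gt_eqF.
  lra.
lra.
Qed.

End Lifespan.

(** * The initial datum and its rescaling *)

Section Datum.
Variables (R : realType) (L : R) (k : nat) (m0 : R -> R).
Hypothesis cm0 : Cck k m0.
Hypothesis supp : tsupport m0 `<=` [set x | - L < x < L].

Lemma datum_continuous : continuous m0.
Proof. by case: cm0 => -[_ /(_ 0%N (leq0n _))]. Qed.

Lemma datum_supp x : L <= `|x| -> m0 x = 0.
Proof.
move=> Lx; apply: contrapT => /eqP mx0.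
have : tsupport m0 x by apply: subset_closure.
by move/supp => /=; move: Lx; rewrite ler_normr => /orP[]; lra.
Qed.

Lemma datum_bound : exists2 a, normLinf m0 = a%:E & forall x, `|m0 x| <= a.
Proof.
have c2 : continuous2 (fun x _ : R => m0 x) :=
  continuous_compose datum_continuous (@continuous_proj1 R).
have [B B0 hB] := bounded2 (- L) L 0 0 c2.
have mB x : `|m0 x| <= B.
  have [/datum_supp ->|xL] := leP L `|x|; first by rewrite normr0 ltW.
  by apply: (hB x 0); rewrite ?lexx// -ler_norml ltW.
have hge x := normLinf_ge x datum_continuous.
have := normLinf_le mB; move: hge.
case: (normLinf m0) => [a h _|h|h _].
- by exists a => // x; rewrite -lee_fin.
- by rewrite leNgt ltry.
- by have := h 0; rewrite leNgt ltNyr.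
Qed.

End Datum.

(** Integrability and differentiability are available for the scaled datum, from its solution, so
    the unscaled convolution is recovered by dividing by [eps]. *)
Lemma convG_scaled (R : realType) (m0 : R -> R) (eps x : R) : eps != 0 ->
  (forall x, convG_defined (fun y => eps * m0 y) x) ->
  derivable (convG (fun y => eps * m0 y)) x 1 ->
  derive1 (convG (fun y => eps * m0 y)) x = eps * derive1 (convG m0) x.
Proof.
move=> eps0 def der1.
have -> : convG m0 = (fun x => eps^-1 * convG (fun y => eps * m0 y) x).
  apply/funext => z; rewrite /convG -RintegralZl//; last exact: def.
  apply: eq_Rintegral => y _; rewrite [G _ * (eps * _)]mulrCA mulKf//.
have d := derivableP der1.
have d' := is_derive_mul (is_derive_const eps^-1 x) d.
by rewrite !derive1E (@derive_val _ _ _ _ _ _ _ d') mul0r addr0 mulVKf.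
Qed.

Theorem theorem1p2 (R : realType) (L : R) (k : nat) (m0 : R -> R) :
  0 < L -> (1 <= k)%N -> Cck k m0 -> tsupport m0 `<=` [set x | - L < x < L] ->
  (forall T : \bar R, is_Tmax k m0 T ->
     ((normLinf m0 * normL1 m0)^-1 <= T)%E) /\
  ((exists xi : R,
      [/\ - L <= xi <= L,
          m0 xi * derive1 (convG m0) xi < 0 &
          ((2^-1)%:E * normL1 m0 ^+ 3 <
             (`|m0 xi| * derive1 (convG m0) xi ^+ 2)%:E)%E]) ->
   (forall T : \bar R, is_Tmax k m0 T -> (T < +oo)%E) /\
   (forall (eps : R) (T : \bar R), 0 < eps ->
      is_Tmax k (fun x => eps * m0 x) T ->
      ((normLinf m0 * normL1 m0)^-1 * ((eps ^+ 2)^-1)%:E <= T)%E /\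
      (T <= (normL1 m0 ^+ 2)^-1 * ((eps ^+ 2)^-1)%:E)%E)).
Proof.
move=> L0 k1 Cm0 supp.
have [a aE m0a] := datum_bound Cm0 supp.
have cm0 := datum_continuous Cm0.
rewrite aE (normL1E cm0 (datum_supp supp)); set M := intg _ _ _.
have M0 : 0 <= M by apply: intg_ge0.
have a0 : 0 <= a by rewrite (le_trans _ (m0a 0)).
split=> [[Tr| |]|[xi [hxi neg big]]].
- move=> /(lifespan_ge L0 k1 supp m0a); rewrite -/M => h.
  (* A finite [Tr] rules out [a * M = 0], the case in which the inverse is [+oo]; the inverse is
     therefore the real one. *)
  have aM : 0 < a * M.
    rewrite lt_neqAle mulr_ge0// andbT eq_sym; apply: contraTneq h => ->.
    by rewrite mulr0 ler10.
  by rewrite -EFinM inver gt_eqF// lee_fin -[leLHS]mul1r ler_pdivrMr.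
- by rewrite leey.
- by case; rewrite ltNge leNye.
have {}big : M ^+ 3 / 2 < `|m0 xi| * derive1 (convG m0) xi ^+ 2.
  by move: big; rewrite -EFin_expe -EFinM lte_fin mulrC.
split=> [T HT|eps T eps0 HT].
  exact: le_lt_trans (lifespan_le L0 k1 supp HT hxi neg big) (ltry _).
pose n0 x := eps * m0 x.
have nsupp : tsupport n0 `<=` [set x | - L < x < L].
  apply: subset_trans supp; apply: closure_subset => x /=.
  by apply: contra_neq => mx0; rewrite /n0 mx0 mulr0.
have nM : intg (- L) L (fun x => `|n0 x|) = eps * M.
  rewrite -intgZ; last by continuity.
  by apply: eq_intg => x _; rewrite normrM gtr0_norm.
have n0a x : `|n0 x| <= eps * a by rewrite normrM gtr0_norm// ler_pM2l.
have epsN0 : eps != 0 by rewrite gt_eqF.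
have nd : derive1 (convG n0) xi = eps * derive1 (convG m0) xi.
  have [T0 [u [m [[cnu _ hconv _ hinit] _ _]]]] := HT.
  have t0 : time_interval T 0 by [].
  have m0E : m^~ 0 = n0 by apply/funext.
  have uE : convG n0 = u^~ 0.
    by apply/funext => x; rewrite (hconv x 0 t0).2 m0E.
  apply: convG_scaled => //; first by move=> x; have := (hconv x 0 t0).1; rewrite m0E.
  have := uE; rewrite /n0 => ->; case: cnu => h _ _ _.
  exact: (h 0%N xi 0 isT t0).
have dm0 : m0 xi != 0 by apply: contraTneq neg => ->; rewrite mul0r ltxx.
have apos : 0 < a by apply: lt_le_trans (m0a xi); rewrite normr_gt0.
have up : (T <= (((eps * M) ^+ 2)^-1)%:E)%E.
  (* Both conditions at [xi] are homogeneous in the datum: scaling multiplies the first by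
     [eps ^+ 2] and both sides of the second by [eps ^+ 3]. *)
  rewrite -nM; apply: (lifespan_le L0 k1 nsupp HT hxi).
    rewrite nd /n0; have -> : eps * m0 xi * (eps * derive1 (convG m0) xi) =
      eps ^+ 2 * (m0 xi * derive1 (convG m0) xi) by ring.
    by rewrite pmulr_rlt0// exprn_gt0.
  rewrite nM nd /n0 normrM (gtr0_norm eps0).
  have -> : (eps * M) ^+ 3 / 2 = eps ^+ 3 * (M ^+ 3 / 2) by ring.
  have -> : eps * `|m0 xi| * (eps * derive1 (convG m0) xi) ^+ 2 =
    eps ^+ 3 * (`|m0 xi| * derive1 (convG m0) xi ^+ 2) by ring.
  by rewrite ltr_pM2l// exprn_gt0.
have T0 : (0 < T)%E by case: HT.
case: T HT up T0 => [Tr| |] HT up T0; [|by move: up; rewrite leNgt ltry|by []].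
have low := lifespan_ge L0 k1 nsupp n0a HT; rewrite nM in low.
have Mpos : 0 < M.
  rewrite lt_neqAle M0 andbT eq_sym; apply: contraTneq low => ->.
  by rewrite !mulr0 ler10.
have aM : 0 < a * M by rewrite mulr_gt0.
rewrite -EFin_expe -EFinM !inver !gt_eqF ?exprn_gt0// -!EFinM; split.
  rewrite lee_fin -invfM -[leLHS]mul1r ler_pdivrMr ?mulr_gt0 ?exprn_gt0//.
  by apply: le_trans low _; rewrite le_eqVlt; apply/orP; left; apply/eqP; ring.
by move: up; rewrite exprMn invfM mulrC.
Qed.
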